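(* Let $L,T,\omega,b\in(0,\infty)$, let $\mathbf{e_g}\in\mathbb{R}^3$ with $|\mathbf{e_g}|=1$, and let $\mathbf f:[0,L]\times[0,T]\to\mathbb{R}^3$ be continuous. For $N\in\mathbb{N}$ and $\tau=T/N$ let $(\mathbf r_k)_{k=0}^N$ be the discrete fiber solution defined in the context and let $\mathbf r^\tau\in\mathcal{H}^{2,1}(\Omega;\mathbb{R}^3)$ be its piecewise linear in time interpolation. Then there exists $0<K<\infty$, independent of $N\in\mathbb{N}$ (equivalently, of the time step $\tau>0$), such that $$\max_{1\le k\le N}\|(\mathrm D\mathbf r^\tau)_k\|_{\mathcal{L}^2(\Omega_L)}\le K,\qquad\max_{0\le k\le N}\|\partial_{ss}\mathbf r_k\|_{\mathcal{L}^2(\Omega_L)}\le K,$$ $$\|\mathbf r^\tau\|_{\mathcal{H}^{2,1}(\Omega)}\le K,\qquad\text{and}\qquad\tau\,\|\partial_{ss}\partial_t\mathbf r^\tau\|^2_{\mathcal{L}^2(\Omega)}\le K .$$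
   Context: $\Omega_L=(0,L)$, $\Omega_T=(0,T)$, $\Omega=\Omega_L\times\Omega_T$. $\mathcal{H}^{2,1}(\Omega;\mathbb{R}^3)$ is the Hilbert space of functions on $\Omega$ that are twice weakly differentiable in $s$, once weakly differentiable in $t$, and square integrable together with these derivatives, with $\|\mathbf v\|^2_{\mathcal{H}^{2,1}(\Omega)}=\|\mathbf v\|^2+\|\partial_s\mathbf v\|^2+\|\partial_{ss}\mathbf v\|^2+\|\partial_t\mathbf v\|^2$ ($\mathcal{L}^2(\Omega)$-norms). For $N\in\mathbb{N}$ let $\tau=T/N$, $t_k=k\tau$, $\mathbf f_k=\mathbf f(\cdot,t_k)$. Let $\mathcal V=\{\mathbf v\in\mathcal{H}^2(\Omega_L;\mathbb{R}^3):\mathbf v(L)=\mathbf 0,\ \partial_s\mathbf v(L)=-\mathbf{e_g}\}$. Set $\mathbf r_0(s)=\mathbf r_1(s)=(L-s)\mathbf{e_g}$. Recursively for $k=1,\dots,N-1$, given $\mathbf r_{k-1},\mathbf r_k\in\mathcal V$, put $\mathrm D^2_{k+1}\mathbf v=(\mathbf v-2\mathbf r_k+\mathbf r_{k-1})/\tau^2$, $$J_{k+1}(\mathbf v)=\omega\|\tau\mathrm D_{k+1}^2\mathbf v\|^2_{\mathcal{L}^2(\Omega_L)}+b\|\partial_{ss}\mathbf v\|^2_{\mathcal{L}^2(\Omega_L)}-2(\mathbf f_{k+1},\mathbf v)_{\mathcal{L}^2(\Omega_L)},\quad e_{k+1}(\mathbf v)=2\,\partial_s(\mathbf v-\mathbf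 r_k)\cdot\partial_s\mathbf r_k,$$ $\mathcal K_{k+1}=\{\mathbf v\in\mathcal V: e_{k+1}(\mathbf v)=0\}$, and let $\mathbf r_{k+1}$ be the unique minimizer of $J_{k+1}$ over $\mathcal K_{k+1}$. Interpolation: $\mathbf r^\tau(s,t)=\frac{t-t_{k-1}}{\tau}(\mathbf r_k-\mathbf r_{k-1})(s)+\mathbf r_{k-1}(s)$ for $t\in(t_{k-1},t_k]$, $k=1,\dots,N$. Discrete derivative: $(\mathrm D\mathbf r^\tau)_k=(\mathbf r_k-\mathbf r_{k-1})/\tau$, $k=1,\dots,N$. *)

(* Defs.v *)
From HB Require Import structures.
From mathcomp Require Import all_boot all_order all_algebra.
From mathcomp Require Import all_classical all_reals all_analysis.

Set Implicit Arguments.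
Unset Strict Implicit.
Unset Printing Implicit Defensive.

Import Order.TTheory GRing.Theory Num.Theory.
Import numFieldNormedType.Exports.

Local Open Scope classical_set_scope.
Local Open Scope ring_scope.

Section Euclidean.
Variable R : realType.

(* The norm that the library puts on row vectors is the sup norm, hence these
   Euclidean versions. *)
Definition dotv (u v : 'rV[R]_3) : R := \sum_i u 0 i * v 0 i.

Definition normv (u : 'rV[R]_3) : R := Num.sqrt (dotv u u).

End Euclidean.

Section L2.
Context {R : realType} {d : measure_display} {X : measurableType d}.
Variables (mu : {measure set X -> \bar R}) (D : set X).
Implicit Types u v : X -> 'rV[R]_3.

Definition L2norm u : \bar R :=
  'N[mu]_(2%:E)[(fun x => (normv (u x))%:E) \_ D]%E.

Definition L2dot u v : \bar R := (\int[mu]_(x in D) (dotv (u x) (v x))%:E)%E.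

Definition inL2 u : Prop :=
  (forall i, measurable_fun D (fun x => u x 0 i)) /\ (L2norm u < +oo)%E.

End L2.

Section TestFunctions.
Context {R : realType} {V : normedModType R}.

Definition iter_derive (vs : seq V) (phi : V -> R) : V -> R :=
  foldr (fun v g x => 'D_v g x) phi vs.

(* For V = R and V = R * R this is C_c^oo(D): in finite dimension a function is
   smooth iff all its iterated directional derivatives are differentiable. *)
Definition test_function (D : set V) (phi : V -> R) : Prop :=
  [/\ forall (vs : seq V) (x : V), differentiable (iter_derive vs phi) x,
      compact (closure [set x | phi x != 0])
    & closure [set x | phi x != 0] `<=` D].

End TestFunctions.

Section Sobolev.
Variable R : realType.
Implicit Types L T : R.

Definition leb1 : {measure set (measurableTypeR R) -> \bar R} :=
  @lebesgue_measure R.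

Definition leb2 : {measure set (measurableTypeR R * measurableTypeR R) -> \bar R} :=
  (@lebesgue_measure R \x @lebesgue_measure R)%E.

Definition OmegaL L : set R := `]0, L[.

Definition Omega L T : set (R * R) := `]0, L[ `*` `]0, T[.

(* g is the weak derivative of u on (0, L) of order n. *)
Definition weak_deriv1 L (n : nat) (u g : R -> 'rV[R]_3) : Prop :=
  forall phi : R -> R, test_function (OmegaL L) phi -> forall i,
  (\int[leb1]_(s in OmegaL L) (u s 0 i * @iter_derive R R (nseq n 1) phi s)%:E =
   ((-1) ^+ n)%:E * \int[leb1]_(s in OmegaL L) (g s 0 i * phi s)%:E)%E.

(* g is the weak derivative of u on (0, L) x (0, T), m times in s (the first
   variable) and n times in t (the second one). *)
Definition weak_deriv2 L T (m n : nat) (u g : R * R -> 'rV[R]_3) : Prop :=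
  forall phi : R * R -> R, test_function (Omega L T) phi -> forall i,
  (\int[leb2]_(z in Omega L T)
     (u z 0 i *
      @iter_derive R (R * R)%type (nseq m (1, 0) ++ nseq n (0, 1)) phi z)%:E =
   ((-1) ^+ (m + n))%:E *
   \int[leb2]_(z in Omega L T) (g z 0 i * phi z)%:E)%E.

(* An element of H^2((0, L); R^3) is packaged with its weak derivatives, which
   are unique up to a null set. *)
Record H2 L := MkH2 {
  H2fun :> R -> 'rV[R]_3 ;
  H2ds : R -> 'rV[R]_3 ;
  H2dss : R -> 'rV[R]_3 ;
  H2_inL2 : [/\ inL2 leb1 (OmegaL L) H2fun, inL2 leb1 (OmegaL L) H2ds
              & inL2 leb1 (OmegaL L) H2dss] ;
  H2_weak : weak_deriv1 L 1 H2fun H2ds /\ weak_deriv1 L 2 H2fun H2dss }.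

Record H21 L T := MkH21 {
  H21fun :> R * R -> 'rV[R]_3 ;
  H21ds : R * R -> 'rV[R]_3 ;
  H21dss : R * R -> 'rV[R]_3 ;
  H21dt : R * R -> 'rV[R]_3 ;
  H21_inL2 : [/\ inL2 leb2 (Omega L T) H21fun, inL2 leb2 (Omega L T) H21ds,
                 inL2 leb2 (Omega L T) H21dss & inL2 leb2 (Omega L T) H21dt] ;
  H21_weak : [/\ weak_deriv2 L T 1 0 H21fun H21ds,
                 weak_deriv2 L T 2 0 H21fun H21dss
               & weak_deriv2 L T 0 1 H21fun H21dt] }.

Definition H21norm L T (v : H21 L T) : \bar R :=
  sqrte (L2norm leb2 (Omega L T) v ^+ 2 +
         L2norm leb2 (Omega L T) (H21ds v) ^+ 2 +
         L2norm leb2 (Omega L T) (H21dss v) ^+ 2 +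
         L2norm leb2 (Omega L T) (H21dt v) ^+ 2)%E.

(* The boundary value at L of an a.e. class on (0, L): the value at L of its
   representative that is continuous on [0, L]. *)
Definition trace_at L (u : R -> 'rV[R]_3) (c : 'rV[R]_3) : Prop :=
  exists w : R -> 'rV[R]_3,
    [/\ {within `[0, L], continuous w},
        {ae leb1, forall s, OmegaL L s -> w s = u s} & w L = c].

End Sobolev.

Arguments leb1 {R}.
Arguments leb2 {R}.

Section Scheme.
Variable R : realType.
Variables (L T omega b : R) (eg : 'rV[R]_3) (f : R * R -> 'rV[R]_3) (N : nat).

Definition tau : R := T / N%:R.

Definition tk (k : nat) : R := k%:R * tau.

Definition inV (v : H2 L) : Prop :=
  trace_at L v 0 /\ trace_at L (H2ds v) (- eg).

Implicit Type r : nat -> H2 L.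

(* In D2, J, e_constr, inK and is_minimizer, the index k is that of the current
   iterate r_k: they stand for D^2_{k+1}, J_{k+1}, e_{k+1}, K_{k+1}, and the
   minimality of u as r_{k+1}. *)
Definition D2 r (k : nat) (v : H2 L) : R -> 'rV[R]_3 :=
  fun s => (tau ^- 2) *: (v s - 2 *: r k s + r k.-1 s).

Definition J r (k : nat) (v : H2 L) : \bar R :=
  (omega%:E * L2norm leb1 (OmegaL L) (fun s => tau *: D2 r k v s) ^+ 2 +
   b%:E * L2norm leb1 (OmegaL L) (H2dss v) ^+ 2 -
   2%:E * L2dot leb1 (OmegaL L) (fun s => f (s, tk k.+1)) v)%E.

Definition e_constr r (k : nat) (v : H2 L) : R -> R :=
  fun s => 2 * dotv (H2ds v s - H2ds (r k) s) (H2ds (r k) s).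

Definition inK r (k : nat) (v : H2 L) : Prop :=
  inV v /\ {ae leb1, forall s, OmegaL L s -> e_constr r k v s = 0}.

Definition is_minimizer r (k : nat) (u : H2 L) : Prop :=
  inK r k u /\ forall v : H2 L, inK r k v -> (J r k u <= J r k v)%E.

(* Only the values r 0, ..., r N matter. The minimizer is unique up to a.e.
   equality, so that it is enough to require r_{k+1} to be a minimizer. *)
Definition discrete_solution r : Prop :=
  [/\ {ae leb1, forall s, OmegaL L s -> r 0%N s = (L - s) *: eg},
      {ae leb1, forall s, OmegaL L s -> r 1%N s = (L - s) *: eg}
    & forall k : nat, (1 <= k < N)%N -> is_minimizer r k (r k.+1)].

Definition Dr r (k : nat) : R -> 'rV[R]_3 :=
  fun s => tau^-1 *: (r k s - r k.-1 s).

(* For t in (0, T] exactly one index k contributes to the sum. *)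
Definition interpolant r : R * R -> 'rV[R]_3 := fun z =>
  \sum_(1 <= k < N.+1 | tk k.-1 < z.2 <= tk k)
    (((z.2 - tk k.-1) / tau) *: (r k z.1 - r k.-1 z.1) + r k.-1 z.1).

End Scheme.

(* Main.v *)
(** Comparing r_{k+1} with the segment joining it to r_k inside the affine set
    K_{k+1} gives a discrete energy inequality; summing it over the time steps
    and bounding the largest kinetic energy by Young's inequality controls all
    discrete energies without a Gronwall argument.  The L^2 norms of r_k and of
    its first derivative follow from the second one and the boundary values at
    L: a function with weak derivative g oscillates by at most the L^1 norm of
    g, as one sees by testing with differences of smooth steps.  The
    interpolant is a finite sum of products h(t) u(s), whose weak derivatives
    come from Fubini's theorem, the hat functions in t being differences of
    ramps. *)
Require Import Defs.
From mathcomp Require Import all_boot all_order all_algebra.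
From mathcomp Require Import all_classical all_reals all_analysis.
From mathcomp Require Import measurable_realfun ring lra.
Import Order.TTheory GRing.Theory Num.Theory.
Import numFieldNormedType.Exports.
Set Implicit Arguments.
Unset Strict Implicit.
Unset Printing Implicit Defensive.
Local Open Scope classical_set_scope.
Local Open Scope ring_scope.

(** The constraint e_{k+1} is linearised at r_k, so r_k is itself admissible and the first variation
    towards r_k is available without a Lagrange multiplier. It gives more than a comparison of
    energies: for the bending term the exact identity 2 (u, u - p) = |u|^2 - |p|^2 + |u - p|^2 keeps
    the dissipation |u - p|^2, and the sum of these terms over the time steps is tau times the
    squared norm of the mixed derivative. All energies vanish at index 1, because r_0 = r_1 is
    affine in s; the force enters only through a bound on |f|^2. Elements of H^2 carry arbitrary
    representatives of their weak derivatives, so that even the derivatives of the straight initial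
    fiber must be identified by a variational lemma; this and the oscillation bound require explicit
    test functions, built from exp(-1/y). Written slot by slot in time, the interpolant is a sum of
    discontinuous terms, which suits the derivatives in s but not the one in t. For the latter it is
    rewritten as r_0 plus increments weighted by continuous functions of t. *)

Section Dotv.
Variable R : realType.
Implicit Types u v w : 'rV[R]_3.

Lemma dotv_ge0 u : 0 <= dotv u u.
Proof. by apply: sumr_ge0 => i _; rewrite -expr2 sqr_ge0. Qed.

Lemma dotvC u v : dotv u v = dotv v u.
Proof. by apply: eq_bigr => i _; rewrite mulrC. Qed.

Lemma dotvDl u v w : dotv (u + v) w = dotv u w + dotv v w.
Proof. by rewrite -big_split; apply: eq_bigr => i _ /=; rewrite !mxE mulrDl. Qed.

Lemma dotvZl a u w : dotv (a *: u) w = a * dotv u w.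
Proof. by rewrite /dotv mulr_sumr; apply: eq_bigr => i _ /=; rewrite !mxE mulrA. Qed.

Lemma dotvDr u v w : dotv w (u + v) = dotv w u + dotv w v.
Proof. by rewrite dotvC dotvDl !(dotvC w). Qed.

Lemma dotvZr a u w : dotv w (a *: u) = a * dotv w u.
Proof. by rewrite dotvC dotvZl dotvC. Qed.

Lemma dotv_young u v : 2 * `|dotv u v| <= dotv u u + dotv v v.
Proof.
have := dotv_ge0 (u + v); have := dotv_ge0 (u - v).
rewrite !dotvDl !dotvDr -scaleN1r !dotvZl !dotvZr (dotvC v u).
case: (ger0P (dotv u v)); lra.
Qed.

Lemma dotv_addsq u v : dotv (u + v) (u + v) <= 2 * (dotv u u + dotv v v).
Proof.
have := dotv_ge0 (u - v).
rewrite !dotvDl !dotvDr -scaleN1r !dotvZl !dotvZr (dotvC v u); lra.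
Qed.

Lemma sqr_coord_le_dotv u i : u 0 i ^+ 2 <= dotv u u.
Proof.
by rewrite /dotv (bigD1 i)//= -expr2 lerDl sumr_ge0// => j _; rewrite -expr2 sqr_ge0.
Qed.

End Dotv.

(** * The L^2 inner product of vector-valued functions *)

Section L2space.
Context {R : realType} {d : measure_display} {X : measurableType d}.
Variables (mu : {measure set X -> \bar R}) (D : set X).
Hypothesis mD : measurable D.
Implicit Types u v : X -> 'rV[R]_3.

(** Real-valued, so that bilinear identities become goals for [ring] and [lra]; on [inL2] it agrees
    with the extended-valued [L2dot] and with the square of [L2norm]. *)
Definition ip u v : R := \int[mu]_(x in D) dotv (u x) (v x).

Lemma L2norm_sq u :
  (L2norm mu D u ^+ 2 = \int[mu]_(x in D) (dotv (u x) (u x))%:E)%E.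
Proof.
rewrite /L2norm unlock /Lnorm poweR12_sqrt; last first.
  by apply: integral_ge0 => x _; exact: poweR_ge0.
rewrite sqr_sqrte; last by apply: integral_ge0 => x _; exact: poweR_ge0.
rewrite [RHS]integral_mkcond.
apply: eq_integral => x _; rewrite !patchE; case: ifP => _ /=.
  by rewrite powR_mulrn// /normv real_normK ?num_real// sqr_sqrtr// dotv_ge0.
by rewrite powR_mulrn// normr0 expr0n.
Qed.

Lemma L2norm_ge0 u : (0 <= L2norm mu D u)%E.
Proof. exact: Lnorm_ge0. Qed.

Lemma measurable_dotv u v :
  (forall i, measurable_fun D (fun x => u x 0 i)) ->
  (forall i, measurable_fun D (fun x => v x 0 i)) ->
  measurable_fun D (fun x => dotv (u x) (v x)).
Proof. by move=> mu' mv; apply: measurable_sum => i; apply: measurable_funM. Qed.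

Lemma integrable_dotvv u : inL2 mu D u ->
  mu.-integrable D (fun x => (dotv (u x) (u x))%:E).
Proof.
move=> [m lty]; apply/integrableP; split.
  by apply/measurable_EFinP; exact: measurable_dotv.
under eq_integral do rewrite gee0_abs ?lee_fin ?dotv_ge0//.
by rewrite -L2norm_sq; apply: lte_mul_pinfty; rewrite ?L2norm_ge0// ge0_fin_numE// L2norm_ge0.
Qed.

Lemma inL2P u : (forall i, measurable_fun D (fun x => u x 0 i)) ->
  mu.-integrable D (fun x => (dotv (u x) (u x))%:E) -> inL2 mu D u.
Proof.
move=> m /integrableP[_ lty]; split => //.
rewrite ltey; apply/eqP => E; move: lty.
under eq_integral do rewrite gee0_abs ?lee_fin ?dotv_ge0//.
by rewrite -L2norm_sq E expeS mulyy ltxx.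
Qed.

Lemma integrable_dotv u v : inL2 mu D u -> inL2 mu D v ->
  mu.-integrable D (fun x => (dotv (u x) (v x))%:E).
Proof.
move=> u2 v2; have := integrableD mD (integrable_dotvv u2) (integrable_dotvv v2).
apply: le_integrable => //.
  by apply/measurable_EFinP; apply: measurable_dotv; [case: u2|case: v2].
move=> x _ /=; rewrite lee_fin [leRHS]ger0_norm ?addr_ge0 ?dotv_ge0//.
by have := dotv_young (u x) (v x); have := normr_ge0 (dotv (u x) (v x)); lra.
Qed.

Lemma inL2_lin a c u v : inL2 mu D u -> inL2 mu D v ->
  inL2 mu D (fun x => a *: u x + c *: v x).
Proof.
move=> u2 v2.
have m i : measurable_fun D (fun x => (a *: u x + c *: v x) 0 i).
  under eq_fun do rewrite !mxE.
  by apply: measurable_funD; apply: measurable_funM => //; [case: u2|case: v2].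
apply: inL2P => //.
have := integrableD mD (integrableZl mD (2 * a ^+ 2) (integrable_dotvv u2))
  (integrableZl mD (2 * c ^+ 2) (integrable_dotvv v2)).
apply: le_integrable => //.
  by apply/measurable_EFinP; exact: measurable_dotv.
move=> x _ /=; rewrite lee_fin !ger0_norm ?dotv_ge0//; last first.
  by rewrite addr_ge0// mulr_ge0 ?dotv_ge0// mulr_ge0// sqr_ge0.
have := dotv_addsq (a *: u x) (c *: v x); rewrite !(dotvZl, dotvZr); lra.
Qed.

Lemma inL2B u v : inL2 mu D u -> inL2 mu D v -> inL2 mu D (fun x => u x - v x).
Proof.
move=> u2 v2; have := inL2_lin 1 (-1) u2 v2.
by under eq_fun do rewrite scale1r scaleN1r.
Qed.

Lemma inL2Z a u : inL2 mu D u -> inL2 mu D (fun x => a *: u x).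
Proof.
move=> u2; have := inL2_lin a 0 u2 u2.
by under eq_fun do rewrite scale0r addr0.
Qed.

Lemma L2norm_sq_ip u : inL2 mu D u -> (L2norm mu D u ^+ 2 = (ip u u)%:E)%E.
Proof.
move=> u2; rewrite L2norm_sq /ip /Rintegral fineK// integrable_fin_num//.
exact: integrable_dotvv.
Qed.

Lemma L2dot_ip u v : inL2 mu D u -> inL2 mu D v -> L2dot mu D u v = (ip u v)%:E.
Proof.
by move=> u2 v2; rewrite /L2dot /ip /Rintegral fineK// integrable_fin_num//; exact: integrable_dotv.
Qed.

Lemma ip_ge0 u : 0 <= ip u u.
Proof. by apply: Rintegral_ge0 => x _; exact: dotv_ge0. Qed.

Lemma ipC u v : ip u v = ip v u.
Proof. by apply: eq_Rintegral => x _; exact: dotvC. Qed.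

Lemma ip_lin a c u v w : inL2 mu D u -> inL2 mu D v -> inL2 mu D w ->
  ip (fun x => a *: u x + c *: v x) w = a * ip u w + c * ip v w.
Proof.
move=> u2 v2 w2; rewrite /ip -!RintegralZl//; try exact: integrable_dotv.
rewrite -RintegralD//.
- by apply: eq_Rintegral => x _; rewrite dotvDl !dotvZl.
- have := integrableZl mD a (integrable_dotv u2 w2); exact: eq_integrable.
- have := integrableZl mD c (integrable_dotv v2 w2); exact: eq_integrable.
Qed.

Lemma ipB u v w : inL2 mu D u -> inL2 mu D v -> inL2 mu D w ->
  ip (fun x => u x - v x) w = ip u w - ip v w.
Proof.
move=> u2 v2 w2; have := ip_lin 1 (-1) u2 v2 w2.
rewrite mul1r mulN1r => <-; apply: eq_Rintegral => x _.
by rewrite scale1r scaleN1r.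
Qed.

Lemma ipZ a u w : inL2 mu D u -> inL2 mu D w ->
  ip (fun x => a *: u x) w = a * ip u w.
Proof.
move=> u2 w2; have := ip_lin a 0 u2 u2 w2.
rewrite mul0r addr0 => <-; apply: eq_Rintegral => x _.
by rewrite scale0r addr0.
Qed.

(** Expand the squared norm of e u - v, which is nonnegative, and divide by e. *)
Lemma ip_young u v (e : R) : 0 < e -> inL2 mu D u -> inL2 mu D v ->
  2 * ip u v <= e * ip u u + e^-1 * ip v v.
Proof.
move=> e0 u2 v2.
have := ip_ge0 (fun x => e *: u x + (-1) *: v x).
have w2 := inL2_lin e (-1) u2 v2.
rewrite (ip_lin _ _ u2 v2 w2) (ipC u) (ipC v) (ip_lin _ _ u2 v2 u2).
rewrite (ip_lin _ _ u2 v2 v2) (ipC v u) => H.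
have {}H : 0 <= e^-1 * (e * (e * ip u u + -1 * ip u v) + -1 * (e * ip u v + -1 * ip v v)).
  by rewrite mulr_ge0// invr_ge0 ltW.
have E : e^-1 * (e * (e * ip u u + -1 * ip u v) + -1 * (e * ip u v + -1 * ip v v)) =
  e * ip u u + e^-1 * ip v v - 2 * ip u v by field; rewrite gt_eqF.
by rewrite E in H; lra.
Qed.

Lemma L2norm_le u (K : R) : 0 <= K -> inL2 mu D u -> ip u u <= K ^+ 2 ->
  (L2norm mu D u <= K%:E)%E.
Proof.
move=> K0 u2 uK; rewrite -(@lee_sqr R)//; last exact: L2norm_ge0.
by rewrite L2norm_sq_ip// -EFin_expe lee_fin.
Qed.

Lemma eq_ae_ip u v w : {ae mu, forall x, D x -> u x = v x} ->
  inL2 mu D u -> inL2 mu D v -> inL2 mu D w -> ip u w = ip v w.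
Proof.
move=> uv u2 v2 w2; rewrite /ip /Rintegral; congr fine.
apply: ae_eq_integral => //.
- by apply/measurable_EFinP; apply: measurable_dotv; [case: u2|case: w2].
- by apply/measurable_EFinP; apply: measurable_dotv; [case: v2|case: w2].
by apply: filterS uv => x /[apply] ->.
Qed.

End L2space.

(** * Smooth steps *)

Section Smooth.
Variable R : realType.
Implicit Types f g : R -> R.

(** Derivatives are supplied as explicit witnesses rather than through the operator ['D_1], which
    turns closure under sums, products and inverses into inductions on the order. *)
Fixpoint diffn (n : nat) f : Prop :=
  if n is m.+1 then
    exists f' : R -> R, (forall x : R, is_derive x (1 : R) f (f' x)) /\ diffn m f'
  else True.

Definition smooth f := forall n, diffn n f.

Lemma diffnW n f : diffn n.+1 f -> diffn n f.
Proof.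
elim: n f => [//|n IH] f [f' [df sf']]; exists f'; split => //.
exact: IH.
Qed.

Lemma diffn_cst n (c : R) : diffn n (fun=> c).
Proof.
elim: n c => [//|n IH] c; exists (fun=> 0); split; last exact: IH.
by move=> x; exact: is_derive_cst.
Qed.

Lemma diffnD n f g : diffn n f -> diffn n g -> diffn n (fun x => f x + g x).
Proof.
elim: n f g => [//|n IH] f g [f' [df sf']] [g' [dg sg']].
exists (fun x => f' x + g' x); split; last exact: IH.
by move=> x; exact: is_deriveD.
Qed.

Lemma diffnM n f g : diffn n f -> diffn n g -> diffn n (fun x => f x * g x).
Proof.
elim: n f g => [//|n IH] f g sf sg.
have [f' [df sf']] := sf; have [g' [dg sg']] := sg.
exists (fun x => f x * g' x + g x * f' x); split.
  by move=> x; exact: is_deriveM.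
by apply: diffnD; apply: IH => //; exact: diffnW.
Qed.

Lemma diffnZ n c f : diffn n f -> diffn n (fun x => c * f x).
Proof. by move=> sf; apply: diffnM => //; exact: diffn_cst. Qed.

Lemma diffnB n f g : diffn n f -> diffn n g -> diffn n (fun x => f x - g x).
Proof.
move=> sf sg; have := diffnD sf (diffnZ (-1) sg).
by under eq_fun do rewrite mulN1r.
Qed.

(** The derivative - (1/f)^2 f' involves 1/f only to one order less, where the induction hypothesis
    and the product rule apply. *)
Lemma diffnV n f : (forall x, f x != 0) -> diffn n f -> diffn n (fun x => (f x)^-1).
Proof.
move=> f0; elim: n => [//|n IH] sf; have [f' [df sf']] := sf.
exists (fun x => (- 1) * ((f x)^-1 * (f x)^-1 * f' x)); split.
  move=> x; apply: (is_derive_eq (is_deriveV (f0 x) (df x))).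
  by rewrite /GRing.scale/= expr2 invfM; ring.
apply: diffnZ; apply: diffnM => //.
by apply: diffnM; apply: IH; exact: diffnW.
Qed.

Lemma is_derive_affine (c a : R) (x : R) : is_derive x 1 (fun y => c * y + a) c.
Proof.
apply: is_derive_eq.
by rewrite /GRing.scale/= mulr1 addr0.
Qed.

Lemma is_derive_comp_affine f (df c a x : R) : is_derive (c * x + a) 1 f df ->
  is_derive x 1 (fun y => f (c * y + a)) (c * df).
Proof.
move=> H; rewrite mulrC; apply: (@is_derive1_comp _ f (fun y => c * y + a)) => //.
exact: is_derive_affine.
Qed.

Lemma diffn_comp_affine n f (c a : R) : diffn n f -> diffn n (fun x => f (c * x + a)).
Proof.
elim: n f => [//|n IH] f [f' [df sf']].
exists (fun x => c * f' (c * x + a)); split.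
  by move=> x; exact: is_derive_comp_affine.
by apply: diffnZ; exact: IH.
Qed.

(** Test functions on R are differentiated in arbitrary directions; linearity of the differential
    reduces them all to the direction 1. *)
Lemma derive_dirE f (x v : R) : derivable f x 1 -> 'D_v f x = v * 'D_1 f x.
Proof.
move=> /derivable1_diffP df.
by rewrite !deriveE// -[in LHS](mulr1 v) linearZ.
Qed.

Lemma smooth_derive f (v : R) : smooth f -> smooth (fun x => 'D_v f x).
Proof.
move=> sf n; have [f' [df sf']] := sf n.+1.
have -> : (fun x => 'D_v f x) = (fun x => v * f' x).
  by apply/funext => x; rewrite derive_dirE ?derive_val.
exact: diffnZ.
Qed.

Lemma smooth_iter_derive f (vs : seq R) : smooth f -> smooth (iter_derive vs f).
Proof. by move=> sf; elim: vs => [//|v vs IH]; exact: smooth_derive. Qed.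

Lemma smooth_differentiable f x : smooth f -> differentiable f x.
Proof. by move=> sf; have [f' [df _]] := sf 1%N; apply/derivable1_diffP. Qed.

Lemma smooth_test (D : set R) f (a c : R) : smooth f -> `[a, c] `<=` D ->
  (forall x, f x != 0 -> a <= x <= c) -> test_function D f.
Proof.
move=> sf acD fac.
have sub : closure [set x | f x != 0] `<=` `[a, c].
  have E : `[a, c]%classic = closure `[a, c]%classic.
    by apply/closure_id; exact: interval_closed.
  rewrite E.
  by apply: closure_subset => x /fac; rewrite /= in_itv.
split.
- by move=> vs x; apply: smooth_differentiable; exact: smooth_iter_derive.
- apply: subclosed_compact sub; first exact: closed_closure.
  exact: segment_compact.
- exact: subset_trans acD.
Qed.

(* y^-k exp(-1/y), extended by 0: the derivatives of exp(-1/y) are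
   combinations of these functions. *)
Definition expV (k : nat) (y : R) : R :=
  if 0 < y then y ^- k * expR (- y^-1) else 0.

Lemma expV_ge0 k y : 0 <= expV k y.
Proof.
by rewrite /expV; case: ifPn => // y0; rewrite mulr_ge0 ?expR_ge0// invr_ge0 exprn_ge0// ltW.
Qed.

Lemma expV_gt0 k y : 0 < y -> 0 < expV k y.
Proof. by move=> y0; rewrite /expV y0 mulr_gt0 ?expR_gt0// invr_gt0 exprn_gt0. Qed.

Lemma expV_eq0 k y : y <= 0 -> expV k y = 0.
Proof. by rewrite /expV leNgt => /negbTE ->. Qed.

(** The single term of order k + 2 in the exponential series at 1/y outweighs y^-k. The remaining
    factor y^2 makes the difference quotient at 0 tend to 0. *)
Lemma expV_le k y : 0 <= y -> expV k y <= (k.+2)`!%:R * y ^+ 2.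
Proof.
move=> y0; rewrite /expV; case: ifPn => [{}y0|_]; last by rewrite mulr_ge0// sqr_ge0.
have /(_ (ltW _)) H := @expR_ge1Dxn R y^-1 k.+1.
have {}H : y^-1 ^+ k.+2 / (k.+2)`!%:R <= expR y^-1.
  by apply: le_trans (H _); rewrite ?lerDr ?ler01 ?invr_gt0// lerDr.
have f0 : 0 < (k.+2)`!%:R :> R by rewrite ltr0n fact_gt0.
rewrite expRN ler_pdivrMr ?expR_gt0//.
apply: le_trans (ler_wpM2l _ H); last by rewrite mulr_ge0 ?ltW// exprn_gt0.
rewrite le_eqVlt; apply/orP; left; apply/eqP.
rewrite exprVn -addn2 exprD; field.
by rewrite !gt_eqF ?exprn_gt0.
Qed.

Lemma is_derive_expV k (y : R) : is_derive y (1 : R) (expV k) (expV k.+2 y - k%:R * expV k.+1 y).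
Proof.
have [y0|y0|->] := ltgtP y 0.
- rewrite !expV_eq0 ?mulr0 ?subr0; try exact: ltW.
  apply: (near_eq_is_derive _ (is_derive_cst (0 : R) y (1 : R))).
  near=> z; rewrite expV_eq0//; near: z; exact: lt_le_nbhsl.
- have yn : y != 0 by rewrite gt_eqF.
  have dV : is_derive y 1 (fun y : R => y^-1) (- y ^- 2).
    by apply: (is_derive_eq (is_deriveV yn (is_derive_id _ _))); rewrite /GRing.scale/= mulr1.
  have dX : is_derive y 1 (fun y : R => y^-1 ^+ k) (k%:R * y^-1 ^+ k.-1 * (- y ^- 2)).
    have := is_derive_eq (is_deriveX k dV); rewrite exprfctE; apply.
    by rewrite /GRing.scale/=.
  have dE : is_derive y 1 (fun y : R => expR (- y^-1)) (expR (- y^-1) * y ^- 2).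
    apply: (@is_derive1_comp _ expR (fun y : R => - y^-1)).
    by apply: (is_derive_eq (is_deriveN dV)); rewrite opprK.
  have dM : is_derive y (1 : R) (fun y : R => y^-1 ^+ k * expR (- y^-1))
      (expV k.+2 y - k%:R * expV k.+1 y).
    apply: (is_derive_eq (is_deriveM dX dE)).
    rewrite /expV y0 /GRing.scale/=.
    case: k {dX} => [|k]; rewrite ?exprS ?expr0 ?exprVn /= ?invfM; first by field.
    by rewrite -natr1; field; rewrite yn expf_neq0.
  apply: (near_eq_is_derive _ dM).
  near=> z; rewrite /expV ifT ?exprVn//; near: z; exact: lt_nbhsr.
(* At 0 the slope function is [expV k z / z], continuous with value 0 there by the quadratic bound
   [expV_le]. *)
- rewrite !expV_eq0// mulr0 subr0; apply/is_derive1_caratheodory.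
  exists (fun z => expV k z / z); split.
  + move=> z; rewrite (expV_eq0 k (lexx (0 : R))) !subr0.
    have [->|z0] := eqVneq z 0; first by rewrite expV_eq0// mul0r mul0r.
    by rewrite divfK.
  + rewrite /prop_for /continuous_at (expV_eq0 k (lexx (0 : R))) mul0r.
    apply/cvgrPdist_le => e e0.
    near=> z; rewrite sub0r normrN.
    have [z0|z0] := leP z 0; first by rewrite expV_eq0// mul0r normr0 ltW.
    rewrite ger0_norm ?divr_ge0 ?expV_ge0 ?(ltW z0)// ler_pdivrMr//.
    apply: le_trans (expV_le k (ltW z0)) _.
    rewrite expr2 mulrA ler_pM2r// -ler_pdivlMl ?ltr0n ?fact_gt0//.
    apply: le_trans (ler_norm _) _; near: z.
    by apply: (@nbhs0_le R R); rewrite mulr_gt0// invr_gt0 ltr0n fact_gt0.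
  + by rewrite expV_eq0// mul0r.
Unshelve. all: by end_near. Qed.

Lemma smooth_expV k : smooth (expV k).
Proof.
move=> n; elim: n k => [//|n IH] k.
exists (fun y => expV k.+2 y - k%:R * expV k.+1 y); split.
  exact: is_derive_expV.
by apply: diffnB; [|apply: diffnZ]; exact: IH.
Qed.

(** The classical smooth transition from 0 on x <= 0 to 1 on x >= 1; the denominator is positive
    because x or 1 - x is. *)
Definition ustep (x : R) : R := expV 0 x / (expV 0 x + expV 0 (1 - x)).

Let den_gt0 x : 0 < expV 0 x + expV 0 (1 - x).
Proof.
have [x0|x0] := leP x 0.
  by rewrite ltr_wpDl ?expV_ge0// expV_gt0// subr_gt0 (le_lt_trans x0).
by rewrite ltr_pwDl ?expV_ge0// expV_gt0.
Qed.

Lemma ustep_itv x : 0 <= ustep x <= 1.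
Proof.
rewrite /ustep divr_ge0 ?expV_ge0//=; last exact/ltW/den_gt0.
by rewrite ler_pdivrMr ?den_gt0// mul1r lerDl expV_ge0.
Qed.

Lemma ustep0 x : x <= 0 -> ustep x = 0.
Proof. by move=> x0; rewrite /ustep expV_eq0// mul0r. Qed.

Lemma ustep1 x : 1 <= x -> ustep x = 1.
Proof.
move=> x1; rewrite /ustep [X in _ + X]expV_eq0 ?subr_le0// addr0 divff//.
by rewrite gt_eqF// expV_gt0// (lt_le_trans ltr01).
Qed.

Lemma expV_refl n : diffn n (fun x => expV 0 (1 - x)).
Proof.
have := @diffn_comp_affine n (expV 0) (-1) 1 (smooth_expV 0 n).
by under eq_fun do rewrite mulN1r addrC.
Qed.

Lemma smooth_ustep : smooth ustep.
Proof.
move=> n; apply: diffnM; first exact: smooth_expV.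
apply: diffnV; first by move=> x; rewrite gt_eqF.
by apply: diffnD; [exact: smooth_expV|exact: expV_refl].
Qed.

(** The quotient rule leaves the numerator A B' + B A', nonnegative since [expV 0] has derivative
    [expV 2]. The sign is what makes the derivative of a step an averaging kernel. *)
Lemma derive_ustep_ge0 (x : R) : 0 <= 'D_1 ustep x.
Proof.
have d1 := is_derive_expV 0 x.
have d2 : is_derive x 1 (fun x => expV 0 (1 - x)) (- expV 2 (1 - x)).
  have := @is_derive_comp_affine (expV 0) _ (-1) 1 x (is_derive_expV 0 _).
  under eq_fun do rewrite mulN1r addrC.
  by rewrite !mulN1r !mul0r subr0 (addrC _ 1).
have dV := @is_deriveV _ (fun y => expV 0 y + expV 0 (1 - y)) x _ 1
  (lt0r_neq0 (den_gt0 x)) (is_deriveD d1 d2).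
have dU : is_derive x (1 : R) ustep _ := is_deriveM d1 dV.
rewrite (@derive_val _ _ _ _ _ _ _ dU).
rewrite mul0r subr0 /GRing.scale/=.
have := den_gt0 x; set A := expV 0 x; set B := expV 0 (1 - x).
set A' := expV 2 x; set B' := expV 2 (1 - x) => AB.
have -> : A * (- (A + B) ^- 2 * (A' - B')) + (A + B)^-1 * A' =
   (A * B' + B * A') * (A + B) ^- 2 by field; rewrite gt_eqF.
by rewrite mulr_ge0 ?invr_ge0 ?sqr_ge0// addr_ge0// mulr_ge0// expV_ge0.
Qed.

(** For d > 0, the transition from 0 to 1 across [a, a + d]. The argument is kept in the shape c * x
    + a' of the affine chain rule. *)
Definition stepat (a d x : R) : R := ustep (d^-1 * x + - (d^-1 * a)).

Lemma smooth_stepat a d : smooth (stepat a d).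
Proof. by move=> n; apply: diffn_comp_affine; exact: smooth_ustep. Qed.

Lemma stepat_itv a d x : 0 <= stepat a d x <= 1.
Proof. exact: ustep_itv. Qed.

Lemma stepat0 a d x : 0 < d -> x <= a -> stepat a d x = 0.
Proof.
by move=> d0 xa; rewrite /stepat ustep0// -mulrBr pmulr_rle0 ?invr_gt0// subr_le0.
Qed.

Lemma stepat1 a d x : 0 < d -> a + d <= x -> stepat a d x = 1.
Proof.
move=> d0 xa; rewrite /stepat ustep1// -mulrBr mulrC ler_pdivlMr// mul1r.
by rewrite lerBrDl.
Qed.

Lemma derive_stepat_ge0 (a d x : R) : 0 < d -> 0 <= 'D_1 (stepat a d) x.
Proof.
move=> d0; set y := d^-1 * x + - (d^-1 * a).
have du : is_derive y 1 ustep ('D_1 ustep y).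
  by apply/derivableP/derivable1_diffP/smooth_differentiable; exact: smooth_ustep.
rewrite (@derive_val _ _ _ _ _ _ _ (is_derive_comp_affine du)).
by rewrite mulr_ge0 ?invr_ge0 ?derive_ustep_ge0// ltW.
Qed.

(** Neither step has compact support, but both are 0 to the left of [a] and 1 to the right of
    [c + d], so that their difference does. *)
Lemma stepatB_test (D : set R) a c d : 0 < d -> a <= c -> `[a, c + d] `<=` D ->
  test_function D (fun x => stepat a d x - stepat c d x).
Proof.
move=> d0 ac acD; apply: (smooth_test _ acD).
  by move=> n; apply: diffnB; exact: smooth_stepat.
move=> x; have [xa|xa] /= := leP x a.
  by rewrite !stepat0 ?subrr ?eqxx// (le_trans xa).
have [xc|xa'] := leP x (c + d); first by rewrite (ltW xa).
rewrite (@stepat1 c)// ?(ltW xa')// (@stepat1 a)// ?subrr ?eqxx//.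
by rewrite (le_trans _ (ltW xa'))// lerD2r.
Qed.

End Smooth.

(** * Supports and bounds of the derivatives of test functions *)

Section TestFunctionTheory.
Context {R : realType} {V : normedModType R}.
Variables (D : set V) (phi : V -> R).
Hypothesis tphi : test_function D phi.

Lemma iter_derive_continuous (vs : seq V) : continuous (iter_derive vs phi).
Proof. by case: tphi => d _ _ x; apply: differentiable_continuous; exact: d. Qed.

(** The complement of the closed support is open, so vanishing there passes from a function to its
    directional derivatives. *)
Lemma iter_derive_eq0 (vs : seq V) x :
  ~ closure [set x | phi x != 0] x -> iter_derive vs phi x = 0.
Proof.
set K := closure _; elim: vs x => [|v vs IH] x Kx /=.
  by apply/eqP; apply: contrapT => /negP p0; apply: Kx; exact: subset_closure.
rewrite (@near_eq_derive _ _ _ _ (cst 0)) ?derive_cst//.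
have oK : open (~` K) by apply: closed_openC; exact: closed_closure.
by near=> y; apply: IH; near: y; exact: (open_nbhs_nbhs (conj oK Kx)).
Unshelve. all: by end_near. Qed.

Lemma iter_derive_eq0D (vs : seq V) x : ~ D x -> iter_derive vs phi x = 0.
Proof. by move=> Dx; apply: iter_derive_eq0 => /(let: And3 _ _ s := tphi in s x). Qed.

Lemma iter_derive_bounded (vs : seq V) :
  exists2 M, 0 < M & forall x, `|iter_derive vs phi x| <= M.
Proof.
case: tphi => _ cK _.
have := continuous_compact (continuous_subspaceT (@iter_derive_continuous vs)) cK.
move=> /compact_bounded [M [_ MP]]; exists (`|M| + 1); first by rewrite ltr_wpDl.
move=> x; have [Kx|Kx] := pselect (closure [set x | phi x != 0] x).
  by apply: MP; [rewrite ltr_pwDr// ler_norm|exists x].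
by rewrite iter_derive_eq0// normr0 addr_ge0.
Qed.

(** Allows a weak identity to be tested with a derivative of a test function, which is how
    identities of different orders are compared. *)
Lemma test_function_iter_derive (vs : seq V) : test_function D (iter_derive vs phi).
Proof.
have sub : closure [set x | iter_derive vs phi x != 0] `<=` closure [set x | phi x != 0].
  rewrite [X in _ `<=` X]((closure_id _).1 (@closed_closure _ _)).
  apply: closure_subset => x /= p0; apply: contrapT => Kx; move: p0.
  by rewrite iter_derive_eq0 ?eqxx.
case: tphi => d cK KD; split.
- by move=> ws x; rewrite /iter_derive -foldr_cat; exact: d.
- by apply: subclosed_compact sub => //; exact: closed_closure.
- exact: subset_trans KD.
Qed.

End TestFunctionTheory.

(** * Integrals on an interval and averaging kernels *)

Section OneD.
Variable R : realType.
Implicit Types (L : R) (f g w : R -> R).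
Notation mu := (@leb1 R).

Lemma mOmegaL L : measurable (OmegaL L : set (measurableTypeR R)).
Proof. exact: measurable_itv. Qed.

Lemma mu_OmegaL L : 0 < L -> mu (OmegaL L) = L%:E.
Proof. by move=> L0; rewrite [LHS](lebesgue_measure_itv `]0, L[) /= lte_fin L0 oppr0 adde0. Qed.

Lemma continuous_measurable (D : set R) f : continuous f ->
  measurable_fun (D : set (measurableTypeR R)) f.
Proof. by move=> cf; apply: measurable_funTS; exact: continuous_measurable_fun. Qed.

Lemma integrable_oo_within (a c : R) f : {within `[a, c], continuous f} ->
  mu.-integrable `]a, c[ (EFin \o f).
Proof.
move=> cf; apply: (@integrableS _ (measurableTypeR R) _ mu `[a, c]%classic) => //.
  exact: subset_itv_oo_cc.
by apply: continuous_compact_integrable => //; exact: segment_compact.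
Qed.

Lemma integrable_OmegaL_within L f : {within `[0, L], continuous f} ->
  mu.-integrable (OmegaL L) (EFin \o f).
Proof. exact: integrable_oo_within. Qed.

Lemma Rintegral_oo_cc (a c : R) f : {within `[a, c], continuous f} ->
  \int[mu]_(x in `]a, c[) f x = \int[mu]_(x in `[a, c]) f x.
Proof.
move=> cf; have i1 := integrable_oo_within cf.
have i2 : mu.-integrable `[a, c] (EFin \o f).
  by apply: continuous_compact_integrable => //; exact: segment_compact.
rewrite Rintegral_itv_bndo_bndc// Rintegral_itv_obnd_cbnd//.
by apply: integrableS i2 => //; exact: subset_itv_oc_cc.
Qed.

Lemma FTC_oo (a c : R) F f : a < c -> (forall x : R, is_derive x (1 : R) F (f x)) ->
  continuous f -> \int[mu]_(x in `]a, c[) f x = F c - F a.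
Proof.
move=> ac dF cf; rewrite Rintegral_oo_cc//; last exact: continuous_subspaceT.
have cF : continuous F.
  move=> x; apply: differentiable_continuous; apply/derivable1_diffP.
  by have [] := dF x.
rewrite /Rintegral (continuous_FTC2 ac (F := F)) -?EFinB//.
- exact: continuous_subspaceT.
- split.
  + by move=> x _; have [] := dF x.
  + exact/cvg_at_right_filter/cF.
  + exact/cvg_at_left_filter/cF.
- by move=> x _; rewrite derive1E; have [_ ->] := dF x.
Qed.

Lemma FTC_OmegaL L F f : 0 < L -> (forall x : R, is_derive x (1 : R) F (f x)) ->
  continuous f -> \int[mu]_(x in OmegaL L) f x = F L - F 0.
Proof. exact: FTC_oo. Qed.

Lemma integrable_Mbounded (D : set R) f g (M : R) :
  measurable (D : set (measurableTypeR R)) -> measurable_fun D g ->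
  (forall x, `|g x| <= M) -> mu.-integrable D (EFin \o f) ->
  mu.-integrable D (fun x => (f x * g x)%:E).
Proof.
move=> mD mg gM fi.
have -> : (fun x => (f x * g x)%:E) = ((EFin \o g) \* (EFin \o f))%E.
  by apply/funext => x /=; rewrite mulrC.
apply: integrableMr => //; exists M; split; first exact: num_real.
by move=> N MN x _ /=; rewrite (le_trans (gM x))// ltW.
Qed.

Lemma Rintegral_eq_EFin (D : set R) f : measurable (D : set (measurableTypeR R)) ->
  mu.-integrable D (EFin \o f) ->
  (\int[mu]_(x in D) (f x)%:E)%E = (\int[mu]_(x in D) f x)%:E.
Proof. by move=> mD fi; rewrite /Rintegral fineK// integrable_fin_num. Qed.

Lemma stepat_continuous (a d : R) : continuous (stepat a d).
Proof.
move=> x; apply: differentiable_continuous; apply: smooth_differentiable.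
exact: smooth_stepat.
Qed.

Lemma is_derive_stepat (a d x : R) : is_derive x (1 : R) (stepat a d) ('D_1 (stepat a d) x).
Proof.
apply/derivableP/derivable1_diffP/smooth_differentiable; exact: smooth_stepat.
Qed.

Lemma derive_stepat_continuous (a d : R) : continuous (fun x => 'D_1 (stepat a d) x).
Proof.
move=> x; apply: differentiable_continuous; apply: smooth_differentiable.
by apply: smooth_derive; exact: smooth_stepat.
Qed.

Lemma derive_stepat_eq0 (a d x : R) : 0 < d -> x < a \/ a + d < x -> 'D_1 (stepat a d) x = 0.
Proof.
move=> d0 [xa|xa].
  rewrite (@near_eq_derive _ _ _ _ (cst 0)) ?derive_cst//.
  near=> y; rewrite stepat0//; near: y; exact: lt_le_nbhsl.
rewrite (@near_eq_derive _ _ _ _ (cst (1 : R))) ?derive_cst//.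
near=> y; rewrite stepat1//; near: y; exact: lt_le_nbhsr.
Unshelve. all: by end_near. Qed.

(* The kernel 'D_1 (stepat a d) is nonnegative, of mass 1 and supported in
   [a, a + d]. *)
Lemma stepat_average L w (a d e : R) : 0 < L -> 0 < d -> 0 < a -> a + d < L ->
  {within `[0, L], continuous w} ->
  (forall x, a <= x <= a + d -> `|w x - w a| <= e) ->
  `|\int[mu]_(x in OmegaL L) (w x * 'D_1 (stepat a d) x) - w a| <= e.
Proof.
move=> L0 d0 a0 adL cw we.
set k := fun x => 'D_1 (stepat a d) x.
have ck : continuous k := @derive_stepat_continuous a d.
have ik : \int[mu]_(x in OmegaL L) k x = 1.
  rewrite (FTC_OmegaL L0 (@is_derive_stepat a d) ck).
  by rewrite stepat1 ?stepat0 ?subr0// ltW.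
have k0 x : 0 <= k x by exact: derive_stepat_ge0.
have ki c : mu.-integrable (OmegaL L) (EFin \o (fun x => c * k x)).
  apply: integrable_OmegaL_within; apply: continuous_subspaceT => x.
  by apply: cvgM; [exact: cvg_cst|exact: ck].
have cwk : {within `[0, L], continuous (fun x => w x * k x)}.
  by move=> x; apply: cvgM; [exact: cw|exact: continuous_subspaceT].
have wki := integrable_OmegaL_within cwk.
have -> : w a = \int[mu]_(x in OmegaL L) (w a * k x).
  rewrite RintegralZl ?ik ?mulr1//; first exact: mOmegaL.
  by have := ki 1; under eq_fun do rewrite mul1r.
rewrite -RintegralB//; last exact: mOmegaL.
have wki' : mu.-integrable (OmegaL L) (EFin \o (fun x => w x * k x - w a * k x)).
  by have := integrableB (@mOmegaL L) wki (ki (w a)).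
apply: le_trans (le_normr_Rintegral (@mOmegaL L) wki') _.
have -> : e = \int[mu]_(x in OmegaL L) (e * k x).
  rewrite RintegralZl ?ik ?mulr1//; first exact: mOmegaL.
  by have := ki 1; under eq_fun do rewrite mul1r.
apply: le_Rintegral => //; [exact: mOmegaL|exact: integrable_norm|].
move=> x _; rewrite -mulrBl normrM (ger0_norm (k0 x)).
have [ax|ax] := leP a x; last by rewrite /k derive_stepat_eq0 ?mulr0//; left.
have [xa|xa] := leP x (a + d); last by rewrite /k derive_stepat_eq0 ?mulr0//; right.
by rewrite ler_wpM2r// we// ax.
Qed.

End OneD.

(** * Weak derivatives on an interval *)

Section VariationalLemma.
Variable R : realType.
Implicit Types (L : R) (f g w : R -> R).
Notation mu := (@leb1 R).

Lemma stepatB_bound (a c d x : R) : `|stepat a d x - stepat c d x| <= 1.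
Proof.
have /andP[? ?] := stepat_itv a d x; have /andP[? ?] := stepat_itv c d x.
by rewrite ler_norml; apply/andP; split; lra.
Qed.

(* The differences of steps at a and c converge boundedly to the indicator of
   ]a, c] as their width tends to 0. *)
Lemma itv_integral_eq0 L g (a c : R) :
  mu.-integrable (OmegaL L) (EFin \o g) ->
  (forall phi, test_function (OmegaL L) phi -> \int[mu]_(x in OmegaL L) (g x * phi x) = 0) ->
  0 < a -> a < c -> c < L -> \int[mu]_(x in OmegaL L) (g x * \1_(`]a, c]) x) = 0.
Proof.
move=> gi g0 a0 ac cL.
(* The factor (L - c) / 2 keeps the support [a, c + dn n] inside (0, L) for every n. *)
pose dn n : R := (L - c) / 2 * harmonic n.
have cL2 : 0 < (L - c) / 2 by rewrite divr_gt0// subr_gt0.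
have dn0 n : 0 < dn n by rewrite /dn mulr_gt0 ?harmonic_gt0.
have dnL n : c + dn n < L.
  rewrite -ltrBrDl; apply: (@le_lt_trans _ _ ((L - c) / 2)).
    by rewrite /dn ler_piMr ?(ltW cL2)// invf_le1// ler1n.
  by rewrite ltr_pdivrMr// ltr_pMr ?subr_gt0// ltr1n.
have dncvg : dn n @[n --> \oo] --> 0.
  by rewrite -[X in _ --> X](mulr0 ((L - c) / 2)); apply: cvgMr; exact: cvg_harmonic.
have near_dn (e : R) : 0 < e -> \forall n \near \oo, dn n <= e.
  by move=> e0; near=> n; apply/ltW; near: n; exact: (cvgr_lt 0 dncvg).
pose fn n x := (g x * (stepat a (dn n) x - stepat c (dn n) x))%:E.
pose fl x := (g x * \1_(`]a, c]) x)%:E.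
have mg : measurable_fun (OmegaL L) g by apply/measurable_EFinP; exact: (measurable_int mu).
have mfn n : measurable_fun (OmegaL L) (fn n).
  apply/measurable_EFinP; apply: measurable_funM => //.
  by apply: measurable_funB; apply: continuous_measurable; exact: stepat_continuous.
have mfl : measurable_fun (OmegaL L) fl.
  apply/measurable_EFinP; apply: measurable_funM => //.
have fnfl : {ae mu, forall x, OmegaL L x -> fn ^~ x @ \oo --> fl x}.
  (* At each point the sequence is eventually constant. A step is still 0 at its left end, so the
     limit interval contains [c] but not [a]. *)
  apply: aeW => x _; apply: cvg_near_cst; rewrite /fn /fl indicE.
  have [xa|ax] := leP x a.
    near=> n; rewrite !stepat0// ?(le_trans xa (ltW ac))// subrr.
    by rewrite memNset//= in_itv/= ltNge xa.
  have [xc|cx] := leP x c.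
    near=> n; rewrite (stepat0 (dn0 n) xc) stepat1//; last first.
      by rewrite -lerBrDl; near: n; apply: near_dn; rewrite subr_gt0.
    by rewrite subr0 mem_set//= in_itv/= ax.
  near=> n; rewrite !stepat1//.
  - by rewrite subrr memNset//= in_itv/= ax/= leNgt cx.
  - by rewrite -lerBrDl; near: n; apply: near_dn; rewrite subr_gt0.
  - rewrite -lerBrDl; near: n; apply: near_dn; rewrite subr_gt0//.
have agi := integrable_norm gi.
have dom : {ae mu, forall x n, OmegaL L x -> (`|fn n x| <= (`|g x|)%:E)%E}.
  apply: aeW => x n _; rewrite /fn /= lee_fin normrM ler_piMr//.
  exact: stepatB_bound.
have [ifl _ lim] := dominated_convergence (@mOmegaL R L) mfn mfl fnfl agi dom.
have E n : (\int[mu]_(x in OmegaL L) fn n x = 0)%E.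
  have t : test_function (OmegaL L) (fun x => stepat a (dn n) x - stepat c (dn n) x).
    apply: stepatB_test => //; first exact: ltW.
    move=> x; rewrite /OmegaL /= !in_itv/= => /andP[ax xc].
    by rewrite (lt_le_trans a0)// (le_lt_trans xc).
  rewrite /fn Rintegral_eq_EFin; [by rewrite g0|exact: mOmegaL|].
  apply: (integrable_Mbounded (M := 1)) => //; first exact: mOmegaL.
    by apply: measurable_funB; apply: continuous_measurable; exact: stepat_continuous.
  by move=> x; exact: stepatB_bound.
have l0 : (\int[mu]_(x in OmegaL L) fn n x)%E @[n --> \oo] --> (0 : \bar R)%E.
  by under eq_fun do rewrite E; exact: cvg_cst.
by rewrite /Rintegral (cvg_unique _ lim l0).
Unshelve. all: by end_near. Qed.

(** The primitive of [g], extended by 0, has zero increments over intervals ]a, c] inside (0, L),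
    hence is constant there; by Lebesgue differentiation [g] is almost everywhere its derivative. *)
Lemma variational_lemma L g : mu.-integrable (OmegaL L) (EFin \o g) ->
  (forall phi, test_function (OmegaL L) phi -> \int[mu]_(x in OmegaL L) (g x * phi x) = 0) ->
  {ae mu, forall s, OmegaL L s -> g s = 0}.
Proof.
move=> gi g0.
have H a c : 0 < a -> a < c -> c < L -> \int[mu]_(x in `]a, c]) ((g \_ (OmegaL L)) x) = 0.
  move=> a0 ac cL; rewrite -(itv_integral_eq0 gi g0 a0 ac cL).
  rewrite -Rintegral_mkcondl Rintegral_mkcondr; apply: eq_Rintegral => x _.
  by rewrite patchE indicE; case: ifP => _; rewrite ?mulr1 ?mulr0.
have gT : mu.-integrable setT (EFin \o (g \_ (OmegaL L))).
  by rewrite -restrict_EFin -integrable_mkcond//; exact: mOmegaL.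
have gS (D : set (measurableTypeR R)) : measurable D ->
    mu.-integrable D (EFin \o (g \_ (OmegaL L))).
  by move=> mD; apply: integrableS gT.
have := @FTC1Ny R (g \_ (OmegaL L)) _ (integrable_locally (@mOmegaL R L) gi).
move=> /(_ (fun y => gS _ (measurable_itv _))).
apply: filterS; first exact: (ae_filter_ringOfSetsType mu).
move=> s [_ +] Ls; rewrite patchE mem_set// => <-.
pose F x := \int[mu]_(t in `]-oo, x]) ((g \_ (OmegaL L)) t).
rewrite -[LHS]/(derive1 F s) derive1E.
have Fc y z : OmegaL L y -> OmegaL L z -> y < z -> F y = F z.
  rewrite /OmegaL /= !in_itv/= => /andP[y0 yL] /andP[z0 zL] yz.
  apply/eqP; rewrite eq_sym -subr_eq0; apply/eqP.
  rewrite /F Rintegral_itvB ?bnd_simp ?(ltW yz)//; first exact: H.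
  exact: gS (measurable_itv _).
rewrite (@near_eq_derive _ _ _ _ (cst (F s))) ?derive_cst//.
have oO : open (OmegaL L) by exact: interval_open.
near=> y.
have Ly : OmegaL L y by near: y; exact: (open_nbhs_nbhs (conj oO Ls)).
have [ys|sy|->//] := ltgtP y s; first exact: Fc.
by rewrite /= (Fc s y).
Unshelve. all: by end_near. Qed.

End VariationalLemma.

Section Trace.
Variable R : realType.
Implicit Types (L : R) (f g w : R -> R).
Notation mu := (@leb1 R).

Let dist_transfer (A C I G p q e : R) : A - C = - I -> `|I| <= G ->
  `|A - p| <= e / 2 -> `|C - q| <= e / 2 -> `|p - q| <= e + G.
Proof.
rewrite !ler_norml => AC /andP[? ?] /andP[? ?] /andP[? ?].
by apply/andP; split; lra.
Qed.

(** The average of [w] against the derivative of a narrow step at p is close to w p, and the test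
    function itself is bounded by 1, which leaves the L^1 norm of [g]. *)
Lemma weak_oscillation L g w (a c : R) :
  mu.-integrable (OmegaL L) (EFin \o g) -> {within `[0, L], continuous w} ->
  (forall phi, test_function (OmegaL L) phi ->
     \int[mu]_(x in OmegaL L) (w x * 'D_1 phi x) = - \int[mu]_(x in OmegaL L) (g x * phi x)) ->
  0 < a -> a < c -> c < L -> `|w a - w c| <= \int[mu]_(x in OmegaL L) `|g x|.
Proof.
move=> gi cw wg a0 ac cL; apply/ler_addgt0Pl => e e0.
have L0 : 0 < L by rewrite (lt_trans a0)// (lt_trans ac).
have [cwi _ _] := (continuous_within_itvP _ L0).1 cw.
have near_w (p : R) : 0 < p -> p < L -> exists2 r, 0 < r &
    forall x, p <= x <= p + r -> `|w x - w p| <= e / 2.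
  move=> p0 pL; have pi : p \in `]0, L[ by rewrite in_itv/= p0 pL.
  have /cvgrPdist_le /(_ (e / 2)) := cwi p pi.
  rewrite divr_gt0// => /(_ isT) /nbhs_ballP[r /= r0 rP]; exists (r / 2).
    by rewrite divr_gt0.
  move=> x /andP[px xp]; rewrite distrC; apply: rP.
  rewrite /ball/= distrC ger0_norm ?subr_ge0//; lra.
have [ra ra0 raP] := near_w a a0 (lt_trans ac cL).
have [rc rc0 rcP] := near_w c (lt_trans a0 ac) cL.
(* The width is small enough for [w] to vary by at most e / 2 across each of the two steps, and for
   c + d to stay below L. *)
pose d := Num.min (Num.min ra rc) ((L - c) / 2).
have d0 : 0 < d by rewrite !lt_min ra0 rc0 divr_gt0// subr_gt0.
have dra : d <= ra by rewrite !ge_min lexx.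
have drc : d <= rc by rewrite !ge_min lexx orbT.
have dL : d <= (L - c) / 2 by rewrite !ge_min lexx !orbT.
have t : test_function (OmegaL L) (fun x => stepat a d x - stepat c d x).
  apply: stepatB_test => //; first exact: ltW.
  move=> x; rewrite /OmegaL /= !in_itv/= => /andP[ax xc]; apply/andP; split; lra.
have avgA : `|\int[mu]_(x in OmegaL L) (w x * 'D_1 (stepat a d) x) - w a| <= e / 2.
  apply: stepat_average => //; first lra.
  by move=> x /andP[ax xa]; apply: raP; rewrite ax/=; lra.
have avgC : `|\int[mu]_(x in OmegaL L) (w x * 'D_1 (stepat c d) x) - w c| <= e / 2.
  apply: stepat_average => //; [lra|lra|].
  by move=> x /andP[ax xa]; apply: rcP; rewrite ax/=; lra.
have := wg _ t.
have ki p : mu.-integrable (OmegaL L) (EFin \o (fun x => w x * 'D_1 (stepat p d) x)).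
  apply: integrable_OmegaL_within => x; apply: cvgM; first exact: cw.
  by apply: continuous_subspaceT; exact: derive_stepat_continuous.
have -> : \int[mu]_(x in OmegaL L) (w x * 'D_1 (fun x => stepat a d x - stepat c d x) x) =
    \int[mu]_(x in OmegaL L) (w x * 'D_1 (stepat a d) x) -
    \int[mu]_(x in OmegaL L) (w x * 'D_1 (stepat c d) x).
  rewrite -RintegralB//; last exact: mOmegaL.
  apply: eq_Rintegral => x _; rewrite -mulrBr; congr (_ * _).
  have dB := is_deriveB (is_derive_stepat a d x) (is_derive_stepat c d x).
  exact: (@derive_val _ _ _ _ _ _ _ dB).
move=> E.
have gphi : mu.-integrable (OmegaL L)
    (EFin \o (fun x => g x * (stepat a d x - stepat c d x))).
  apply: (integrable_Mbounded (M := 1)) => //; first exact: mOmegaL.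
    by apply: measurable_funB; apply: continuous_measurable; exact: stepat_continuous.
  by move=> x; exact: stepatB_bound.
have G : `|\int[mu]_(x in OmegaL L) (g x * (stepat a d x - stepat c d x))| <=
    \int[mu]_(x in OmegaL L) `|g x|.
  apply: le_trans (le_normr_Rintegral (@mOmegaL R L) gphi) _.
  apply: le_Rintegral; [exact: mOmegaL|exact: integrable_norm|exact: integrable_norm|].
  by move=> x _; rewrite normrM ler_piMr// stepatB_bound.
exact: dist_transfer E G avgA avgC.
Qed.

(** The endpoint L carries the boundary value but lies in the support of no test function; it is
    reached from the left, by continuity of [w] on the closed interval. *)
Lemma weak_oscillation_trace L g w (a : R) :
  mu.-integrable (OmegaL L) (EFin \o g) -> {within `[0, L], continuous w} ->
  (forall phi, test_function (OmegaL L) phi ->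
     \int[mu]_(x in OmegaL L) (w x * 'D_1 phi x) = - \int[mu]_(x in OmegaL L) (g x * phi x)) ->
  0 < a -> a < L -> `|w a - w L| <= \int[mu]_(x in OmegaL L) `|g x|.
Proof.
move=> gi cw wg a0 aL; apply/ler_addgt0Pl => e e0.
have L0 : 0 < L by exact: lt_trans aL.
have [_ _ cwL] := (continuous_within_itvP _ L0).1 cw.
near L^'- => p.
have ap : a < p by near: p; exact: nbhs_left_gt.
have pL : p < L by near: p; exact: nbhs_left_lt.
have wp : `|w L - w p| <= e.
  by near: p; move/cvgrPdist_le : cwL; apply.
have := weak_oscillation gi cw wg a0 ap pL.
have := ler_normD (w a - w p) (w p - w L); rewrite (distrC (w p)).
have -> : w a - w p + (w p - w L) = w a - w L by ring.
lra.
Unshelve. all: by end_near. Qed.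

End Trace.

(** On a set of finite measure L^2 is contained in L^1, through |x| <= 1 + x^2. *)
Lemma inL2_integrable_coord {R : realType} {d} {X : measurableType d}
    (mu : {measure set X -> \bar R}) (D : set X) (u : X -> 'rV[R]_3) i :
  measurable D -> (mu D < +oo)%E -> inL2 mu D u ->
  mu.-integrable D (fun x => (u x 0 i)%:E).
Proof.
move=> mD Dfin u2.
have i1 : mu.-integrable D (EFin \o cst 1).
  apply: measurable_bounded_integrable => //; exact: bounded_cst.
have := integrableD mD i1 (integrable_dotvv u2).
apply: le_integrable => //; first by apply/measurable_EFinP; case: u2.
move=> x _ /=; rewrite lee_fin [leRHS]ger0_norm ?addr_ge0 ?dotv_ge0//.
have := sqr_coord_le_dotv (u x) i; rewrite -(real_normK (num_real (u x 0 i))).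
by have := sqr_ge0 (`|u x 0 i| - 1); rewrite sqrrB mulr1 expr1n; have := normr_ge0 (u x 0 i); lra.
Qed.

Lemma aeS {R : realType} (P Q : R -> Prop) : (forall s, P s -> Q s) ->
  {ae @leb1 R, forall s, P s} -> {ae @leb1 R, forall s, Q s}.
Proof. by move=> PQ; apply: filterS; first exact: (ae_filter_ringOfSetsType leb1). Qed.

Section WeakDerivative.
Variable R : realType.
Variables (L : R) (L0 : 0 < L).
Implicit Types u v g : R -> 'rV[R]_3.
Notation mu := (@leb1 R).
Notation D := (OmegaL L).

Let mD : measurable (D : set (measurableTypeR R)) := @mOmegaL R L.

Lemma OmegaL_fin : (mu D < +oo)%E.
Proof. by rewrite mu_OmegaL// ltry. Qed.

Lemma integrable_coord u i : inL2 mu D u -> mu.-integrable D (EFin \o (fun x => u x 0 i)).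
Proof. by move=> u2; exact: (inL2_integrable_coord i mD OmegaL_fin u2). Qed.

Lemma integrable_coord_test u i phi (vs : seq R) : inL2 mu D u -> test_function D phi ->
  mu.-integrable D (EFin \o (fun x => u x 0 i * iter_derive vs phi x)).
Proof.
move=> u2 t; have [M _ bM] := iter_derive_bounded t vs.
apply: (integrable_Mbounded (M := M)) => //; last exact: integrable_coord.
by apply: continuous_measurable; exact: (iter_derive_continuous t).
Qed.

(** For L^2 functions all integrals involved are finite, so the extended-valued identity can be
    handled in R. *)
Lemma weak_deriv1P n u g : inL2 mu D u -> inL2 mu D g ->
  weak_deriv1 L n u g <-> forall phi, test_function D phi -> forall i,
    \int[mu]_(s in D) (u s 0 i * @iter_derive R R (nseq n 1) phi s) =
    (-1) ^+ n * \int[mu]_(s in D) (g s 0 i * phi s).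
Proof.
move=> u2 g2; split => H phi t i.
  have := H phi t i.
  rewrite (Rintegral_eq_EFin mD (integrable_coord_test i (nseq n 1) u2 t)).
  rewrite (Rintegral_eq_EFin mD (integrable_coord_test i [::] g2 t)).
  by rewrite -EFinM => -[].
rewrite (Rintegral_eq_EFin mD (integrable_coord_test i (nseq n 1) u2 t)).
rewrite (Rintegral_eq_EFin mD (integrable_coord_test i [::] g2 t)).
by rewrite H// EFinM.
Qed.

Lemma Rintegral_coord_lin a c u v i phi (vs : seq R) : inL2 mu D u -> inL2 mu D v ->
  test_function D phi ->
  \int[mu]_(s in D) ((a *: u s + c *: v s) 0 i * iter_derive vs phi s) =
  a * \int[mu]_(s in D) (u s 0 i * iter_derive vs phi s) +
  c * \int[mu]_(s in D) (v s 0 i * iter_derive vs phi s).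
Proof.
move=> u2 v2 t.
have iu := integrable_coord_test i vs u2 t.
have iv := integrable_coord_test i vs v2 t.
have iZ k (h : R -> R) : mu.-integrable D (EFin \o h) ->
    mu.-integrable D (EFin \o (fun s => k * h s)).
  by move=> ih; have := integrableZl mD k ih; exact: eq_integrable.
rewrite -!RintegralZl// -RintegralD//; [|exact: iZ|exact: iZ].
by apply: eq_Rintegral => s _; rewrite !mxE mulrDl !mulrA.
Qed.

Lemma weak_deriv1_lin n a c u v gu gv :
  inL2 mu D u -> inL2 mu D v -> inL2 mu D gu -> inL2 mu D gv ->
  weak_deriv1 L n u gu -> weak_deriv1 L n v gv ->
  weak_deriv1 L n (fun s => a *: u s + c *: v s) (fun s => a *: gu s + c *: gv s).
Proof.
move=> u2 v2 gu2 gv2 /weak_deriv1P wu /weak_deriv1P wv.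
apply/weak_deriv1P; [exact: inL2_lin|exact: inL2_lin|move=> phi t i].
rewrite Rintegral_coord_lin// wu// wv//.
have := @Rintegral_coord_lin a c gu gv i phi [::] gu2 gv2 t => /= ->; ring.
Qed.

(** [H2] relates both derivatives to the function itself only. Testing the first-order identity with
    the derivative of phi and comparing with the second-order one links them to each other. *)
Lemma weak_deriv1_next u g h : inL2 mu D u -> inL2 mu D g -> inL2 mu D h ->
  weak_deriv1 L 1 u g -> weak_deriv1 L 2 u h -> weak_deriv1 L 1 g h.
Proof.
move=> u2 g2 h2 /weak_deriv1P wg /weak_deriv1P wh.
apply/weak_deriv1P => // phi t i /=.
have t' := test_function_iter_derive t [:: (1 : R)].
have := wg u2 g2 _ t' i; have := wh u2 h2 phi t i; rewrite /= => -> E.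
by move: E; rewrite !expr1 expr2 => E; lra.
Qed.

Lemma ae_eq_Rintegral_test u v i phi (vs : seq R) : inL2 mu D u ->
  measurable_fun D (fun s => v s 0 i) ->
  test_function D phi -> {ae mu, forall s, D s -> u s = v s} ->
  \int[mu]_(s in D) (u s 0 i * iter_derive vs phi s) =
  \int[mu]_(s in D) (v s 0 i * iter_derive vs phi s).
Proof.
move=> u2 mv t uv; rewrite /Rintegral; congr fine.
have mi : measurable_fun D (iter_derive vs phi).
  by apply: continuous_measurable; exact: (iter_derive_continuous t).
apply: ae_eq_integral => //.
- by apply/measurable_EFinP; apply: measurable_funM => //; case: u2.
- by apply/measurable_EFinP; apply: measurable_funM.
apply: aeS uv => s /[apply]; by move=> ->.
Qed.

Lemma within_coord_continuous (A : set R) u i :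
  {within A, continuous u} -> {within A, continuous (fun s => u s 0 i)}.
Proof.
move=> cu x P /(@coord_continuous R 1 3 0 i (u x)) H.
exact: (cu x _ H).
Qed.

(** Integrate |x| <= 1 + x^2 over an interval of length L: coarser than Cauchy-Schwarz, but already
    expressed through [ip]. *)
Lemma Rintegral_abs_le u i : inL2 mu D u ->
  \int[mu]_(s in D) `|u s 0 i| <= L + ip mu D u u.
Proof.
move=> u2.
have i1 : mu.-integrable D (EFin \o cst (1 : R)).
  apply: measurable_bounded_integrable => //; [exact: OmegaL_fin|exact: bounded_cst].
have LE : \int[mu]_(s in D) cst 1 s = L by rewrite Rintegral_cst// mu_OmegaL// mul1r.
apply: (@le_trans _ _ (\int[mu]_(s in D) (cst 1 s + dotv (u s) (u s)))); last first.
  by rewrite RintegralD// ?LE//; exact: integrable_dotvv.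
apply: le_Rintegral => //.
- by apply: integrable_norm; exact: integrable_coord.
- exact: (integrableD mD i1 (integrable_dotvv u2)).
move=> s _ /=; have := sqr_coord_le_dotv (u s) i.
rewrite -(real_normK (num_real (u s 0 i))).
by have := sqr_ge0 (`|u s 0 i| - 1); rewrite sqrrB mulr1 expr1n; have := normr_ge0 (u s 0 i); lra.
Qed.

(** A Poincare inequality with boundary value at L. Pointwise |w_i| <= |c_i| + int |g_i| <= B, using
    |c_i| <= 1 + |c|^2 and int |g_i| <= L + |g|^2; then 3 counts the components and L is the length
    of the interval. *)
Lemma trace_poincare u g c : inL2 mu D u -> inL2 mu D g -> weak_deriv1 L 1 u g ->
  trace_at L u c ->
  ip mu D u u <= L * (3 * (1 + dotv c c + (L + ip mu D g g)) ^+ 2).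
Proof.
move=> u2 g2 /weak_deriv1P wg [w [cw wu wL]].
set B := 1 + _ + _.
have wb s i : D s -> `|w s 0 i| <= B.
  move=> Ds; have cwi := within_coord_continuous (i := i) cw.
  have gi := integrable_coord i g2.
  have /andP[s0 sL] : 0 < s < L by move: Ds; rewrite /OmegaL /= in_itv/=.
  have := @weak_oscillation_trace R L (fun s => g s 0 i) _ s gi cwi _ s0 sL.
  have mw : measurable_fun D (fun s => w s 0 i).
    by apply/measurable_EFinP; have /measurable_int := integrable_OmegaL_within cwi.
  have wu' : {ae mu, forall s, D s -> u s = w s}.
    by apply: aeS wu => x /[apply].
  (* The oscillation bound concerns the continuous representative [w], so the weak identity of [u]
     is first transferred to it. *)
  have /[swap]/[apply] : forall phi, test_function D phi ->
      \int[mu]_(x in D) (w x 0 i * 'D_1 phi x) = - \int[mu]_(x in D) (g x 0 i * phi x).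
    move=> phi t; have := wg u2 g2 phi t i; rewrite expr1 mulN1r => <-.
    by have := ae_eq_Rintegral_test [:: (1 : R)] u2 mw t wu' => /= ->.
  rewrite wL => H; have {}H := le_trans H (Rintegral_abs_le i g2).
  have : `|w s 0 i| <= `|w s 0 i - c 0 i| + `|c 0 i|.
    by rewrite -[X in `|X| <= _](subrK (c 0 i)) ler_normD.
  have := sqr_coord_le_dotv c i; rewrite -(real_normK (num_real (c 0 i))).
  have := sqr_ge0 (`|c 0 i| - 1); rewrite sqrrB mulr1 expr1n /B.
  have := normr_ge0 (c 0 i); lra.
have -> : L * (3 * B ^+ 2) = \int[mu]_(s in D) cst (3 * B ^+ 2) s.
  by rewrite Rintegral_cst// mu_OmegaL// mulrC.
have iB : mu.-integrable D (EFin \o cst (3 * B ^+ 2)).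
  apply: measurable_bounded_integrable => //; [exact: OmegaL_fin|exact: bounded_cst].
have mw : measurable_fun D (fun s => dotv (w s) (w s)).
  have mwi i : measurable_fun D (fun s => w s 0 i).
    apply/measurable_EFinP.
    by have /measurable_int := integrable_OmegaL_within (within_coord_continuous (i := i) cw).
  exact: measurable_dotv.
have wB s : D s -> dotv (w s) (w s) <= 3 * B ^+ 2.
  move=> Ds; rewrite /dotv [leRHS](_ : _ = \sum_(i < 3) B ^+ 2); last first.
    by rewrite sumr_const card_ord mulr_natl.
  apply: ler_sum => j _; rewrite -expr2 -(real_normK (num_real (w s 0 j))).
  by rewrite ler_sqr ?nnegrE ?(le_trans _ (wb s j Ds))// wb.
have -> : ip mu D u u = \int[mu]_(s in D) dotv (w s) (w s).
  rewrite /ip /Rintegral; congr fine; apply: ae_eq_integral => //.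
  - by apply/measurable_EFinP; apply: measurable_dotv; case: u2.
  - exact/measurable_EFinP.
  - by apply: aeS wu => x /[apply] ->.
apply: le_Rintegral => //.
apply: le_integrable iB => //; first exact/measurable_EFinP.
move=> s Ds; rewrite /= lee_fin ger0_norm ?dotv_ge0//.
by rewrite (le_trans (wB s Ds))// ler_norm.
Qed.

Lemma coord_ae u v : (forall i, {ae mu, forall s, D s -> u s 0 i = v s 0 i}) ->
  {ae mu, forall s, D s -> u s = v s}.
Proof.
(* The three exceptional sets are merged as a countable family, [inord] mapping nat onto the three
   coordinates. *)
move=> H; have /ae_foralln := fun n : nat => H (inord n).
apply: aeS => s Hs Ds; apply/rowP => i.
by have := Hs i Ds; rewrite inord_val.
Qed.

End WeakDerivative.

(** * Segments, traces and the straight fiber in H^2 *)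

Section H2theory.
Variable R : realType.
Variables (L : R) (L0 : 0 < L).
Implicit Types u v : H2 L.
Notation mu := (@leb1 R).
Notation D := (OmegaL L).

Let mD : measurable (D : set (measurableTypeR R)) := @mOmegaL R L.

Lemma H2_fun_inL2 u : inL2 mu D u. Proof. by have [] := H2_inL2 u. Qed.
Lemma H2_ds_inL2 u : inL2 mu D (H2ds u). Proof. by have [] := H2_inL2 u. Qed.
Lemma H2_dss_inL2 u : inL2 mu D (H2dss u). Proof. by have [] := H2_inL2 u. Qed.

Lemma H2_ds_weak u : weak_deriv1 L 1 (H2ds u) (H2dss u).
Proof.
have [w1 w2] := H2_weak u; apply: (weak_deriv1_next L0 _ _ _ w1 w2).
- exact: H2_fun_inL2.
- exact: H2_ds_inL2.
- exact: H2_dss_inL2.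
Qed.

Lemma H2lin_inL2 (a c : R) u v :
  [/\ inL2 mu D (fun s => a *: u s + c *: v s),
      inL2 mu D (fun s => a *: H2ds u s + c *: H2ds v s)
    & inL2 mu D (fun s => a *: H2dss u s + c *: H2dss v s)].
Proof.
by split; apply: inL2_lin => //;
  first [exact: H2_fun_inL2|exact: H2_ds_inL2|exact: H2_dss_inL2].
Qed.

Lemma H2lin_weak (a c : R) u v :
  weak_deriv1 L 1 (fun s => a *: u s + c *: v s) (fun s => a *: H2ds u s + c *: H2ds v s) /\
  weak_deriv1 L 2 (fun s => a *: u s + c *: v s) (fun s => a *: H2dss u s + c *: H2dss v s).
Proof.
have [u1 u2] := H2_weak u; have [v1 v2] := H2_weak v.
by split; apply: weak_deriv1_lin => //;
  first [exact: H2_fun_inL2|exact: H2_ds_inL2|exact: H2_dss_inL2].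
Qed.

(** Competitors in the minimization are elements of [H2], so a point of a segment has to be packaged
    with its weak derivatives. *)
Definition H2lin (a c : R) u v : H2 L := MkH2 (H2lin_inL2 a c u v) (H2lin_weak a c u v).

Lemma trace_at_lin (a c : R) (u v : R -> 'rV[R]_3) p q : trace_at L u p -> trace_at L v q ->
  trace_at L (fun s => a *: u s + c *: v s) (a *: p + c *: q).
Proof.
move=> [w [cw wu wL]] [z [cz zv zL]].
exists (fun s => a *: w s + c *: z s); split; last by rewrite wL zL.
  move=> x; apply: cvgD; (apply: cvgZr; [exact: cw||exact: cz]).
have : {ae mu, forall s, (D s -> w s = u s) /\ (D s -> z s = v s)}.
  by apply: filterI; [exact: (ae_filter_ringOfSetsType leb1)|exact: wu|exact: zv].
by apply: aeS => s [wus zvs] Ds; rewrite wus// zvs.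
Qed.

Lemma trace_at_ae (u w : R -> 'rV[R]_3) c : {within `[0, L], continuous w} ->
  {ae mu, forall s, D s -> u s = w s} -> w L = c -> trace_at L u c.
Proof. by move=> cw uw wL; exists w; split => //; apply: aeS uw => s /[apply]. Qed.

(** Integration by parts; the boundary term vanishes at L through the weight L - s and at 0 through
    the support of phi. *)
Lemma test_affine_int phi (vs : seq R) : test_function D phi ->
  \int[mu]_(s in D) ((L - s) * 'D_1 (iter_derive vs phi) s) =
  \int[mu]_(s in D) (iter_derive vs phi s).
Proof.
move=> t; set psi := iter_derive vs phi.
have tp := test_function_iter_derive t vs; rewrite -/psi in tp.
have cp : continuous psi := iter_derive_continuous tp (vs := [::]).
have cdp : continuous (fun s => 'D_1 psi s) := iter_derive_continuous tp (vs := [:: (1 : R)]).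
have dp x : is_derive x (1 : R) psi ('D_1 psi x).
  by apply/derivableP/derivable1_diffP; case: tp => /(_ [::] x).
have dF (x : R) : is_derive x (1 : R) (fun s => (L - s) * psi s)
    ((L - x) * 'D_1 psi x - psi x).
  have dL : is_derive x (1 : R) (fun s : R => L - s) (-1).
    have dB := is_deriveB (is_derive_cst L x (1 : R)) (is_derive_id x (1 : R)).
    by apply: (is_derive_eq dB); rewrite sub0r.
  by apply: (is_derive_eq (is_deriveM dL (dp x))); rewrite /GRing.scale/= mulrN1.
have cL : continuous (fun s : R => L - s).
  by move=> x; apply: cvgB; [exact: cvg_cst|exact: cvg_id].
have cLp : continuous (fun s => (L - s) * 'D_1 psi s).
  by move=> x; apply: cvgM; [exact: cL|exact: cdp].
have cF : continuous (fun s => (L - s) * 'D_1 psi s - psi s).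
  by move=> x; apply: cvgB; [exact: cLp|exact: cp].
have := FTC_OmegaL L0 dF cF; rewrite subrr mul0r sub0r.
have -> : psi 0 = 0.
  by apply: (iter_derive_eq0D t); rewrite /OmegaL /= in_itv/= ltxx.
rewrite mulr0 oppr0 RintegralB//; first by move/eqP; rewrite subr_eq0 => /eqP.
- by apply: integrable_OmegaL_within; exact: continuous_subspaceT.
- by apply: integrable_OmegaL_within; exact: continuous_subspaceT.
Qed.

Lemma measurable_affine (e : 'rV[R]_3) i : measurable_fun D (fun s : R => ((L - s) *: e) 0 i).
Proof.
under eq_fun do rewrite mxE.
apply: continuous_measurable => x; apply: cvgM; last exact: cvg_cst.
by apply: cvgB; [exact: cvg_cst|exact: cvg_id].
Qed.

(** [discrete_solution] prescribes only the values of r_0 and r_1. The derivatives packaged with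
    them are recovered, almost everywhere, by inserting those values in the weak identities and
    applying [variational_lemma]. *)
Lemma affine_weak (e : 'rV[R]_3) u : {ae mu, forall s, D s -> u s = (L - s) *: e} ->
  {ae mu, forall s, D s -> H2ds u s = - e} /\ {ae mu, forall s, D s -> H2dss u s = 0}.
Proof.
move=> ue; have [/weak_deriv1P w1 /weak_deriv1P w2] := H2_weak u.
have {}w1 := w1 L0 (H2_fun_inL2 u) (H2_ds_inL2 u).
have {}w2 := w2 L0 (H2_fun_inL2 u) (H2_dss_inL2 u).
have E phi (vs : seq R) i : test_function D phi ->
    \int[mu]_(s in D) (u s 0 i * 'D_1 (iter_derive vs phi) s) =
    e 0 i * \int[mu]_(s in D) (iter_derive vs phi s).
  move=> t.
  have t' := test_function_iter_derive t (1 :: vs).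
  rewrite -test_affine_int//.
  have -> := ae_eq_Rintegral_test (1 :: vs) (H2_fun_inL2 u) (@measurable_affine e i) t ue.
  rewrite -RintegralZl//.
    by apply: eq_Rintegral => s _ /=; rewrite mxE; ring.
  apply: integrable_OmegaL_within; apply: continuous_subspaceT => x; apply: cvgM.
    by apply: cvgB; [exact: cvg_cst|exact: cvg_id].
  exact: (iter_derive_continuous t' (vs := [::])).
split; apply: coord_ae => i.
- have vl : {ae mu, forall s, D s -> H2ds u s 0 i + e 0 i = 0}.
    apply: variational_lemma.
      have := integrableD mD (integrable_coord L0 i (H2_ds_inL2 u))
        (measurable_bounded_integrable mD (OmegaL_fin L0) (measurable_cst (e 0 i))
          (bounded_cst _ _)).
      by [].
    move=> phi t.
    have := w1 _ t i; have := E phi [::] i t => /= -> /esym/eqP.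
    rewrite expr1 mulN1r eq_sym -subr_eq0 opprK => /eqP <-.
    have ip : mu.-integrable D (EFin \o phi).
      apply: integrable_OmegaL_within; apply: continuous_subspaceT.
      exact: (iter_derive_continuous t (vs := [::])).
    rewrite -RintegralZl// -RintegralD//.
    + by apply: eq_Rintegral => s _; rewrite mulrDl addrC.
    + by have := integrableZl mD (e 0 i) ip; exact: eq_integrable.
    + exact: (integrable_coord_test L0 i [::] (H2_ds_inL2 u) t).
  by apply: aeS vl => s /[apply] /eqP; rewrite addr_eq0 mxE => /eqP.
- have vl : {ae mu, forall s, D s -> H2dss u s 0 i = 0}.
    apply: variational_lemma; first exact: (integrable_coord L0 i (H2_dss_inL2 u)).
    move=> phi t; have := w2 _ t i; rewrite sqrrN expr1n mul1r => <-.
    have := E phi [:: (1 : R)] i t; rewrite /= => ->.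
    have tp := iter_derive_continuous t (vs := [:: (1 : R)]).
    have p0 : phi 0 = 0.
      by apply: (iter_derive_eq0D t [::]); rewrite /OmegaL /= in_itv/= ltxx.
    have pL : phi L = 0.
      by apply: (iter_derive_eq0D t [::]); rewrite /OmegaL /= in_itv/= ltxx andbF.
    rewrite (FTC_OmegaL (F := phi) L0 _ tp); first by rewrite p0 pL subrr mulr0.
    by move=> x; apply/derivableP/derivable1_diffP; case: t => /(_ [::] x).
  by apply: aeS vl => s /[apply] ->; rewrite mxE.
Qed.

Lemma affine_inV (e : 'rV[R]_3) u : {ae mu, forall s, D s -> u s = (L - s) *: e} -> inV e u.
Proof.
move=> ue; have [dse _] := affine_weak ue; split.
  apply: (trace_at_ae (w := fun s => (L - s) *: e)) => //; last by rewrite subrr scale0r.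
  apply: continuous_subspaceT => x; apply: cvgZl.
  by apply: cvgB; [exact: cvg_cst|exact: cvg_id].
apply: (trace_at_ae (w := fun=> - e)) => //.
by apply: continuous_subspaceT => x; exact: cvg_cst.
Qed.

Lemma ip_lin2 (a c : R) (u v : R -> 'rV[R]_3) : inL2 mu D u -> inL2 mu D v ->
  ip mu D (fun s => a *: u s + c *: v s) (fun s => a *: u s + c *: v s) =
  a ^+ 2 * ip mu D u u + 2 * a * c * ip mu D u v + c ^+ 2 * ip mu D v v.
Proof.
move=> u2 v2; have w2 := inL2_lin mD a c u2 v2.
rewrite (ip_lin mD _ _ u2 v2 w2) (ipC mu D u) (ipC mu D v).
rewrite (ip_lin mD _ _ u2 v2 u2) (ip_lin mD _ _ u2 v2 v2) (ipC mu D v u); ring.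
Qed.

End H2theory.

(** The first-order condition at h = 0 for a quadratic increment h X + h^2 Y that is nonnegative on
    (0, 1], obtained without derivatives. *)
Lemma limit0_ge0 {R : realFieldType} (X Y : R) :
  (forall h, 0 < h -> h <= 1 -> 0 <= h * (X + h * Y)) -> 0 <= X.
Proof.
move=> H; rewrite leNgt; apply/negP => X0.
have Y0 : 0 < 1 + `|Y| by rewrite ltr_wpDr.
(* If X < 0, this h satisfies h |Y| < - X / 2, which makes X + h Y negative. *)
pose h := Num.min 1 (- X / (2 * (1 + `|Y|))).
have h0 : 0 < h by rewrite lt_min ltr01 divr_gt0 ?oppr_gt0// mulr_gt0.
have h1 : h <= 1 by rewrite ge_min lexx.
have hX : h * (2 * (1 + `|Y|)) <= - X by rewrite -ler_pdivlMr ?mulr_gt0// ge_min lexx orbT.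
have := H h h0 h1; rewrite pmulr_rge0// => XY.
have : h * Y <= h * `|Y| by rewrite ler_wpM2l ?ler_norm// ltW.
have : 0 <= h * `|Y| by rewrite mulr_ge0// ltW.
lra.
Qed.

(** * The discrete energy inequality *)

Section DiscreteEnergy.
Variable R : realFieldType.
Implicit Types a S Q : nat -> R.

Lemma nat_argmax a n : exists2 k, (1 <= k <= n.+1)%N &
  forall j, (1 <= j <= n.+1)%N -> a j <= a k.
Proof.
elim: n => [|n [k kn kmax]].
  by exists 1%N => // j; rewrite -eqn_leq => /eqP <-.
have [ak|ak] := leP (a k) (a n.+2).
  exists n.+2 => [|j /andP[j1]]; first by rewrite leqnn.
  rewrite leq_eqVlt => /orP[/eqP->//|jn]; apply: le_trans ak.
  by apply: kmax; rewrite j1.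
exists k => [|j /andP[j1]]; first by case/andP: kn => -> /leqW.
rewrite leq_eqVlt => /orP[/eqP->|jn]; first exact: ltW.
by apply: kmax; rewrite j1.
Qed.

(** [a], [S] and [Q] stand for the squared discrete velocity, the squared second derivative and the
    numerical dissipation. The weight omega / (2 T) is tuned so that over a total time T the kinetic
    terms on the right amount to at most half of the largest kinetic energy, which is then
    absorbed. *)
Lemma discrete_energy (T omega b F tau : R) (N : nat) a S Q :
  0 < T -> 0 < omega -> 0 < b -> 0 <= F -> (0 < N)%N -> tau = T / N%:R ->
  (forall k, 0 <= a k) -> (forall k, 0 <= S k) -> (forall k, 0 <= Q k) ->
  a 1%N = 0 -> S 1%N = 0 ->
  (forall k, (1 <= k < N)%N ->
    omega * (a k.+1 - a k) + b * (S k.+1 - S k + Q k.+1) <=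
    tau * (omega / (2 * T) * a k.+1 + 2 * T / omega * F)) ->
  forall m, (1 <= m <= N)%N ->
  omega * a m + b * S m + b * \sum_(1 <= k < m) Q k.+1 <= 4 * T ^+ 2 * F / omega.
Proof.
move=> T0 om0 b0 F0; case: N => // n _ tauE a0 S0 Q0 a1 S1 step.
have N0 : 0 < n.+1%:R :> R by rewrite ltr0n.
have tau0 : 0 < tau by rewrite tauE divr_gt0.
have [K Kn Kmax] := nat_argmax a n.
(* A bound for the right-hand side of every step, divided by tau: the velocity is replaced by its
   maximum, attained at [K]. *)
pose c := omega / (2 * T) * a K + 2 * T / omega * F.
have om2 : 0 <= omega / (2 * T) by apply/ltW; rewrite divr_gt0// mulr_gt0.
have om3 : 0 <= 2 * T / omega by apply/ltW; rewrite divr_gt0// mulr_gt0.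
have c0 : 0 <= c by rewrite addr_ge0// mulr_ge0.
(* Index m + 1 is reached after m steps from index 1, where all energies vanish. *)
have E m : (m <= n)%N ->
    omega * a m.+1 + b * S m.+1 + b * \sum_(1 <= k < m.+1) Q k.+1 <= m%:R * (tau * c).
  elim: m => [_|m IH mn].
    by rewrite a1 S1 big_geq// !mulr0 !addr0 mul0r.
  have {}IH := IH (ltnW mn).
  have st := step m.+1 mn.
  have cm : omega / (2 * T) * a m.+2 + 2 * T / omega * F <= c.
    by rewrite lerD2r; apply: ler_wpM2l => //; exact: Kmax.
  have {}st := le_trans st (ler_wpM2l (ltW tau0) cm).
  rewrite big_nat_recr//= -natr1; set q := \sum_(_ <= _ < _) _ in IH *.
  rewrite !mulrDl mul1r; lra.
have Ec m : (1 <= m <= n.+1)%N ->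
    omega * a m + b * S m + b * \sum_(1 <= k < m) Q k.+1 <= T * c.
  case: m => // m /= mn; apply: le_trans (E m mn) _; rewrite mulrA ler_wpM2r//.
  by rewrite tauE mulrCA ler_piMr ?(ltW T0)// ler_pdivrMr// mul1r ler_nat ltnW.
have sQ m : 0 <= \sum_(1 <= k < m) Q k.+1 by exact: sumr_ge0.
(* For the largest term a K this reads
   omega a_K <= omega a_K / 2 + 2 T^2 F / omega. *)
have H1 : omega * a K <= T * c.
  apply: le_trans (Ec K Kn).
  by rewrite -addrA lerDl addr_ge0// mulr_ge0 ?(ltW b0).
have Tc : T * c = omega * a K / 2 + 2 * T ^+ 2 * F / omega.
  by rewrite /c; field; rewrite !gt_eqF.
move=> m mN; apply: le_trans (Ec m mN) _.
(* Write T c = x / 2 + y with x = omega a_K and y the force term. Then x <= x / 2 + y gives x <= 2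
   y, hence T c <= 2 y. *)
have -> : 4 * T ^+ 2 * F / omega = 2 * (2 * T ^+ 2 * F / omega) by field; rewrite gt_eqF.
move: H1; rewrite Tc; lra.
Qed.

End DiscreteEnergy.

Section EnergyStep.
Variable R : realType.
Variables (L T omega b : R) (eg : 'rV[R]_3) (f : R * R -> 'rV[R]_3) (N : nat).
Hypotheses (L0 : 0 < L) (T0 : 0 < T) (om0 : 0 < omega) (N0 : (0 < N)%N).
Variable r : nat -> H2 L.
Hypothesis sol : discrete_solution T omega b eg f N r.
Notation mu := (@leb1 R).
Notation D := (OmegaL L).
Notation tau := (tau T N).

Let mD : measurable (D : set (measurableTypeR R)) := @mOmegaL R L.
Let tau0 : 0 < tau. Proof. by rewrite divr_gt0// ltr0n. Qed.

Lemma solution_inV k : (1 <= k <= N)%N -> inV eg (r k).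
Proof.
have [_ r1 rmin] := sol; case: k => [//|[|k]] kN.
  exact: affine_inV.
by have [[]] := rmin k.+1 kN.
Qed.

(** Along the segment, v - r_k is a multiple of r_{k+1} - r_k, and the constraint is linear in v -
    r_k. Both ends carry the same boundary data, which affine combinations preserve. *)
Lemma segment_inK k h : (1 <= k < N)%N -> inK eg r k (H2lin L0 (1 - h) h (r k.+1) (r k)).
Proof.
move=> kN; have [_ _ /(_ k kN) [[[tU tdU] eU] _]] := sol.
have [tP tdP] : inV eg (r k).
  by apply: solution_inV; case/andP: kN => -> /ltnW.
split.
  split.
    by have := trace_at_lin (1 - h) h tU tP; rewrite !scaler0 addr0.
  by have := trace_at_lin (1 - h) h tdU tdP; rewrite -scalerDl subrK scale1r.
apply: aeS eU => s /[apply]; rewrite /e_constr /=.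
set U := H2ds (r k.+1) s; set P := H2ds (r k) s => /eqP.
rewrite mulf_eq0 pnatr_eq0/= => /eqP UP.
have -> : (1 - h) *: U + h *: P - P = (1 - h) *: (U - P).
  by rewrite scalerBr -addrA; congr (_ + _); rewrite scalerBl scale1r opprB.
by rewrite dotvZl UP !mulr0.
Qed.

Variable k : nat.
Hypothesis kN : (1 <= k < N)%N.
Hypothesis fL2 : inL2 mu D (fun s => f (s, tk T N k.+1)).

Notation U := (r k.+1).
Notation P := (r k).
Notation M := (r k.-1).
Notation fk := (fun s => f (s, tk T N k.+1)).
Let d1 s : 'rV[R]_3 := U s - P s.
Let d0 s : 'rV[R]_3 := P s - M s.

Let d1_L2 : inL2 mu D d1.
Proof. by apply: inL2B => //; exact: H2_fun_inL2. Qed.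
Let d0_L2 : inL2 mu D d0.
Proof. by apply: inL2B => //; exact: H2_fun_inL2. Qed.

(** The hypotheses are pointwise equalities so that the formula covers r_{k+1} itself, at h = 0, as
    well as the packaged segment. *)
Let J_segment h (v : H2 L) :
  (forall s, v s = (1 - h) *: U s + h *: P s) ->
  (forall s, H2dss v s = (1 - h) *: H2dss U s + h *: H2dss P s) ->
  J T omega b f N r k v =
  (omega * (tau ^- 2 * ((1 - h) ^+ 2 * ip mu D d1 d1 -
       2 * (1 - h) * ip mu D d1 d0 + ip mu D d0 d0)) +
   b * ((1 - h) ^+ 2 * ip mu D (H2dss U) (H2dss U) +
        2 * (1 - h) * h * ip mu D (H2dss U) (H2dss P) +
        h ^+ 2 * ip mu D (H2dss P) (H2dss P)) -
   2 * ((1 - h) * ip mu D U fk + h * ip mu D P fk))%:E.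
Proof.
move=> vE vssE; rewrite /J.
(* On the segment v - 2 r_k + r_{k-1} = (1 - h) (r_{k+1} - r_k) - (r_k - r_{k-1}). *)
pose z s := (1 - h) *: d1 s + (-1) *: d0 s.
have z2 : inL2 mu D z by exact: inL2_lin.
have -> : (fun s => tau *: D2 T N r k v s) = (fun s => tau^-1 *: z s).
  apply/funext => s; rewrite /D2 scalerA.
  have -> : tau * tau ^- 2 = tau^-1 by field; rewrite gt_eqF.
  congr (_ *: _); rewrite vE /z /d1 /d0; apply/rowP => i; rewrite !mxE; ring.
have U2 := H2_dss_inL2 U; have P2 := H2_dss_inL2 P.
have -> : H2dss v = (fun s => (1 - h) *: H2dss U s + h *: H2dss P s) by exact/funext.
have -> : (v : R -> 'rV[R]_3) = (fun s => (1 - h) *: U s + h *: P s) by exact/funext.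
rewrite !L2norm_sq_ip//; last 2 first.
- exact: inL2_lin.
- exact: inL2Z.
rewrite L2dot_ip//; last by apply: inL2_lin => //; exact: H2_fun_inL2.
rewrite (ipC mu D fk) (ip_lin mD _ _ (H2_fun_inL2 U) (H2_fun_inL2 P) fL2).
rewrite ip_lin2// (ipZ mD _ z2)//; last exact: inL2Z.
rewrite (ipC mu D z) (ipZ mD _ z2)// ip_lin2//.
rewrite -!EFinM -!EFinD; congr (_%:E).
by field; rewrite gt_eqF.
Qed.

(** In the first variation, Young's inequality 2 B <= A + C makes the kinetic part telescope,
    whereas the bending part is rewritten exactly by polarization, which retains the squared
    increment of the second derivatives. *)
Lemma energy_step (F : R) : ip mu D fk fk <= F ->
  omega * (tau ^- 2 * ip mu D d1 d1 - tau ^- 2 * ip mu D d0 d0) +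
  b * (ip mu D (H2dss U) (H2dss U) - ip mu D (H2dss P) (H2dss P) +
       ip mu D (fun s => H2dss U s - H2dss P s) (fun s => H2dss U s - H2dss P s)) <=
  tau * (omega / (2 * T) * (tau ^- 2 * ip mu D d1 d1) + 2 * T / omega * F).
Proof.
move=> fF; have [_ _ /(_ k kN) [_ minU]] := sol.
have lin0 (x y : 'rV[R]_3) : x = (1 - 0) *: x + 0 *: y.
  by rewrite subr0 scale1r scale0r addr0.
have J0 := @J_segment 0 U (fun s => lin0 _ _) (fun s => lin0 _ _).
set A := ip mu D d1 d1 in J0 *; set B := ip mu D d1 d0 in J0.
set C := ip mu D d0 d0 in J0 *.
set UU := ip mu D (H2dss U) (H2dss U) in J0 *.
set PP := ip mu D (H2dss P) (H2dss P) in J0 *.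
set UP := ip mu D (H2dss U) (H2dss P) in J0.
set fU := ip mu D U fk in J0; set fP := ip mu D P fk in J0.
(* First variation of J along (1 - h) U + h P at h = 0. *)
have X : 0 <= omega * tau ^- 2 * (2 * B - 2 * A) + b * (2 * UP - 2 * UU) + 2 * (fU - fP).
  apply: (@limit0_ge0 _ _ (omega * tau ^- 2 * A + b * (UU - 2 * UP + PP))) => h h0 h1.
  have := minU _ (segment_inK h kN).
  rewrite (@J_segment h (H2lin L0 (1 - h) h U P))// J0.
  rewrite lee_fin -subr_ge0 -/A -/B -/C -/UU -/PP -/UP -/fU -/fP; congr (0 <= _); ring.
have Q : ip mu D (fun s => H2dss U s - H2dss P s) (fun s => H2dss U s - H2dss P s) =
    UU - 2 * UP + PP.
  have := ip_lin2 1 (-1) (H2_dss_inL2 U) (H2_dss_inL2 P).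
  under eq_fun do rewrite scale1r scaleN1r.
  rewrite -/UU -/UP -/PP => ->; ring.
have Y1 : 2 * B <= A + C.
  by have := ip_young mD ltr01 d1_L2 d0_L2; rewrite invr1 !mul1r.
have fd : fU - fP = ip mu D d1 fk.
  by rewrite [RHS](ipB mD (H2_fun_inL2 U) (H2_fun_inL2 P) fL2).
(* This Young weight for the force term 2 (f, d1) produces exactly the two summands on the right:
   weight * A equals tau * omega / (2 T) times the squared velocity, and the inverse weight is tau *
   2 T / omega. *)
have e0 : 0 < omega / (2 * T * tau) by rewrite divr_gt0// mulr_gt0 ?tau0// mulr_gt0.
have Y2 := ip_young mD e0 d1_L2 fL2; rewrite -/A -fd in Y2.
have Y3 : (omega / (2 * T * tau))^-1 * ip mu D fk fk <= tau * (2 * T / omega * F).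
  have -> : tau * (2 * T / omega * F) = (omega / (2 * T * tau))^-1 * F.
    by field; rewrite !gt_eqF.
  by rewrite ler_wpM2l// invr_ge0 ltW.
have E4 : omega / (2 * T * tau) * A = tau * (omega / (2 * T) * (tau ^- 2 * A)).
  by field; rewrite !gt_eqF.
have ot : 0 <= omega * tau ^- 2 by rewrite mulr_ge0 ?invr_ge0 ?sqr_ge0// ltW.
have Y1' : omega * tau ^- 2 * (2 * B) <= omega * tau ^- 2 * (A + C) by exact: ler_wpM2l.
rewrite Q [leRHS]mulrDr; move: X Y1' Y2 Y3; rewrite E4.
have -> : omega * (tau ^- 2 * A - tau ^- 2 * C) =
    omega * tau ^- 2 * (2 * A) - omega * tau ^- 2 * (A + C) by ring.
have -> : omega * tau ^- 2 * (2 * B - 2 * A) =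
    omega * tau ^- 2 * (2 * B) - omega * tau ^- 2 * (2 * A) by ring.
have -> : b * (UU - PP + (UU - 2 * UP + PP)) = - (b * (2 * UP - 2 * UU)) by ring.
lra.
Qed.

End EnergyStep.

(** * Bounds independent of the time step *)

Section UniformBounds.
Variable R : realType.
Notation mu := (@leb1 R).

Lemma force_bound (L T : R) (f : R * R -> 'rV[R]_3) : 0 < L ->
  {within `[0, L] `*` `[0, T], continuous f} ->
  exists2 F, 0 <= F & forall t, 0 <= t <= T ->
    inL2 mu (OmegaL L) (fun s => f (s, t)) /\
    ip mu (OmegaL L) (fun s => f (s, t)) (fun s => f (s, t)) <= F.
Proof.
move=> L0 cf.
have cK : compact (`[0, L] `*` `[0, T] : set (R * R)).
  by apply: compact_setX; exact: segment_compact.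
have cdot : {within `[0, L] `*` `[0, T], continuous (fun z => dotv (f z) (f z))}.
  have ci i : {within `[0, L] `*` `[0, T], continuous (fun z => f z 0 i)}.
    by move=> z P /(@coord_continuous R 1 3 0 i (f z)) H; exact: (cf z _ H).
  have -> : (fun z => dotv (f z) (f z)) = (fun z => f z 0 0 * f z 0 0 +
      (f z 0 (lift 0 0) * f z 0 (lift 0 0) +
      (f z 0 (lift 0 (lift 0 0)) * f z 0 (lift 0 (lift 0 0)) + 0))).
    by apply/funext => z; rewrite /dotv !big_ord_recl big_ord0.
  move=> z; apply: cvgD; first by apply: cvgM; exact: ci.
  apply: cvgD; first by apply: cvgM; exact: ci.
  by apply: cvgD; [apply: cvgM; exact: ci|exact: cvg_cst].
have /compact_bounded [B [_ BP]] := continuous_compact cdot cK.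
pose F0 := `|B| + 1.
have F00 : 0 <= F0 by rewrite addr_ge0.
have fF s t : 0 <= s <= L -> 0 <= t <= T -> dotv (f (s, t)) (f (s, t)) <= F0.
  move=> s0 t0; apply: le_trans (ler_norm _) _.
  apply: BP; first by rewrite /F0 ltr_pwDr// ler_norm.
  by exists (s, t) => //; split; rewrite /= in_itv/=.
exists (L * F0) => [|t t0]; first by rewrite mulr_ge0// ltW.
have cft : {within `[0, L], continuous (fun s => f (s, t))}.
  apply/subspace_continuousP => s Ls.
  move/subspace_continuousP : cf => /(_ (s, t)).
  have st : (`[0, L] `*` `[0, T]) (s, t) by split; [exact: Ls|rewrite /= in_itv/=].
  (* A neighbourhood of (s, t) contains a box, whose first side is the neighbourhood of s required
     for the slice. *)
  move=> /(_ st) H P /H; rewrite /= /nbhs /= /within /= => -[[A B'] /= [As Bt] AB].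
  apply: filterS As => x Ax Lx; apply: (AB (x, t)) => //=.
    by split => //=; exact: nbhs_singleton.
have iB : mu.-integrable (OmegaL L) (EFin \o cst F0).
  apply: measurable_bounded_integrable; [exact: mOmegaL|exact: OmegaL_fin|by []|exact: bounded_cst].
have mf i : measurable_fun (OmegaL L) (fun s => f (s, t) 0 i).
  apply/measurable_EFinP.
  by have /measurable_int := integrable_OmegaL_within (within_coord_continuous (i := i) cft).
have bf s : OmegaL L s -> dotv (f (s, t)) (f (s, t)) <= F0.
  by rewrite /OmegaL /= in_itv/= => /andP[s0 sL]; apply: fF => //; rewrite !ltW.
have idot : mu.-integrable (OmegaL L) (fun s => (dotv (f (s, t)) (f (s, t)))%:E).
  apply: le_integrable iB => //; first exact: mOmegaL.
    by apply/measurable_EFinP; exact: measurable_dotv.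
  by move=> s Ls; rewrite /= lee_fin ger0_norm ?dotv_ge0// ger0_norm// bf.
split; first exact: inL2P.
have -> : L * F0 = \int[mu]_(s in OmegaL L) cst F0 s.
  by rewrite Rintegral_cst ?mu_OmegaL//= 1?mulrC//; exact: mOmegaL.
by apply: le_Rintegral => //; exact: mOmegaL.
Qed.

Lemma eq0_ae_ip (L : R) (u : R -> 'rV[R]_3) : inL2 mu (OmegaL L) u ->
  {ae mu, forall s, OmegaL L s -> u s = 0} -> ip mu (OmegaL L) u u = 0.
Proof.
move=> u2 u0; have z2 := inL2Z (@mOmegaL R L) 0 u2.
have u0' : {ae mu, forall s, OmegaL L s -> u s = 0 *: u s}.
  by apply: aeS u0 => s /[apply]; rewrite scale0r.
by rewrite (eq_ae_ip (@mOmegaL R L) u0' u2 z2 u2) (ipZ (@mOmegaL R L) _ u2 u2) mul0r.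
Qed.

Lemma uniform_bounds (L T omega b : R) (eg : 'rV[R]_3) (f : R * R -> 'rV[R]_3) :
  0 < L -> 0 < T -> 0 < omega -> 0 < b ->
  {within `[0, L] `*` `[0, T], continuous f} ->
  exists2 K, 0 <= K & forall (N : nat) (r : nat -> H2 L), (0 < N)%N ->
    discrete_solution T omega b eg f N r ->
    [/\ forall k, (1 <= k <= N)%N ->
          tau T N ^- 2 * ip mu (OmegaL L) (fun s => r k s - r k.-1 s)
                                          (fun s => r k s - r k.-1 s) <= K,
        forall k, (k <= N)%N ->
          [/\ ip mu (OmegaL L) (r k) (r k) <= K,
              ip mu (OmegaL L) (H2ds (r k)) (H2ds (r k)) <= K
            & ip mu (OmegaL L) (H2dss (r k)) (H2dss (r k)) <= K]
      & \sum_(1 <= k < N.+1)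
          ip mu (OmegaL L) (fun s => H2dss (r k) s - H2dss (r k.-1) s)
                           (fun s => H2dss (r k) s - H2dss (r k.-1) s) <= K].
Proof.
move=> L0 T0 om0 b0 cf; have [F F0 fF] := force_bound L0 cf.
pose C := 4 * T ^+ 2 * F / omega.
have C0 : 0 <= C by rewrite divr_ge0 ?(ltW om0)// mulr_ge0// mulr_ge0// sqr_ge0.
(* The bound of [trace_poincare] as a function of the squared norm x of the derivative and the
   boundary value c; its monotonicity in x allows it to be iterated. *)
pose B (x : R) (c : 'rV[R]_3) := L * (3 * (1 + dotv c c + (L + x)) ^+ 2).
have B0 x c : 0 <= B x c by rewrite mulr_ge0 ?(ltW L0)// mulr_ge0// sqr_ge0.
have Bm x y c : 0 <= x -> x <= y -> B x c <= B y c.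
  move=> x0 xy; rewrite /B ler_pM2l// ler_pM2l// ler_sqr ?nnegrE; last 2 first.
  - by have := dotv_ge0 c; lra.
  - by have := dotv_ge0 c; lra.
  lra.
(* C bounds the total energy, so C / b bounds the second derivatives and C / omega the velocities.
   K2 and K3 descend to the first derivative and to the function, with boundary values - eg and 0 at
   L. *)
pose K1 := C / b; have K10 : 0 <= K1 by rewrite divr_ge0 ?(ltW b0).
pose K2 := B K1 (- eg); pose K3 := B K2 0.
exists (C / omega + K1 + K2 + K3).
  by rewrite !addr_ge0 ?B0 // divr_ge0 ?(ltW om0).
move=> N r N0 sol.
have tau0 : 0 < tau T N by rewrite divr_gt0// ltr0n.
have [r0 r1 _] := sol.
pose a k := tau T N ^- 2 * ip mu (OmegaL L) (fun s => r k s - r k.-1 s)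
                                          (fun s => r k s - r k.-1 s).
pose S k := ip mu (OmegaL L) (H2dss (r k)) (H2dss (r k)).
pose Q k := ip mu (OmegaL L) (fun s => H2dss (r k) s - H2dss (r k.-1) s)
                           (fun s => H2dss (r k) s - H2dss (r k.-1) s).
have a0 k : 0 <= a k by rewrite mulr_ge0 ?ip_ge0// invr_ge0 sqr_ge0.
have S0 k : 0 <= S k by exact: ip_ge0.
have Q0 k : 0 <= Q k by exact: ip_ge0.
have mD := @mOmegaL R L.
have S00 : S 0%N = 0 by apply: eq0_ae_ip; [exact: H2_dss_inL2|case: (affine_weak L0 r0)].
have S10 : S 1%N = 0 by apply: eq0_ae_ip; [exact: H2_dss_inL2|case: (affine_weak L0 r1)].
have a10 : a 1%N = 0.
  rewrite /a eq0_ae_ip ?mulr0//; first by apply: inL2B => //; exact: H2_fun_inL2.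
  have : {ae mu, forall s, (OmegaL L s -> r 0%N s = (L - s) *: eg) /\
                           (OmegaL L s -> r 1%N s = (L - s) *: eg)}.
    by apply: filterI; [exact: (ae_filter_ringOfSetsType leb1)|exact: r0|exact: r1].
  by apply: aeS => s [e0 e1] Ls; rewrite /= e0// e1// subrr.
have Q10 : Q 1%N = 0.
  apply: eq0_ae_ip; first by apply: inL2B => //; exact: H2_dss_inL2.
  have [_ d0] := affine_weak L0 r0; have [_ d1] := affine_weak L0 r1.
  have : {ae mu, forall s, (OmegaL L s -> H2dss (r 0%N) s = 0) /\
                           (OmegaL L s -> H2dss (r 1%N) s = 0)}.
    by apply: filterI; [exact: (ae_filter_ringOfSetsType leb1)|exact: d0|exact: d1].
  by apply: aeS => s [e0 e1] Ls; rewrite /= e0// e1// subrr.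
have E := @discrete_energy R T omega b F (tau T N) N a S Q T0 om0 b0 F0 N0 erefl a0 S0 Q0 a10 S10.
have {}E : forall m, (1 <= m <= N)%N ->
    omega * a m + b * S m + b * \sum_(1 <= k < m) Q k.+1 <= C.
  apply: E => k kN.
  have tN : 0 <= tk T N k.+1 <= T.
    rewrite /tk mulr_ge0 ?(ltW tau0)//= /tau mulrCA ler_piMr ?(ltW T0)//.
    by rewrite ler_pdivrMr ?ltr0n// mul1r ler_nat; case/andP: kN.
  have [f2 fb] := fF _ tN.
  exact: (energy_step L0 T0 om0 N0 sol kN f2 fb).
have oa m : 0 <= omega * a m by rewrite mulr_ge0 ?(ltW om0).
have bS m : 0 <= b * S m by rewrite mulr_ge0 ?(ltW b0).
have bQ m : 0 <= b * \sum_(1 <= k < m) Q k.+1 by rewrite mulr_ge0 ?(ltW b0) ?sumr_ge0.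
have SK k : (k <= N)%N -> S k <= K1.
  case: k => [_|k kN]; first by rewrite S00.
  rewrite ler_pdivlMr// mulrC; have := E k.+1 kN.
  by have := oa k.+1; have := bQ k.+1; lra.
have inVk k : (k <= N)%N -> inV eg (r k).
  by case: k => [_|k kN]; [exact: affine_inV|exact: (solution_inV L0 sol)].
have dsK k : (k <= N)%N -> ip mu (OmegaL L) (H2ds (r k)) (H2ds (r k)) <= K2.
  move=> kN; have [_ t] := inVk k kN.
  apply: le_trans (trace_poincare L0 (H2_ds_inL2 _) (H2_dss_inL2 _) (H2_ds_weak L0 _) t) _.
  by apply: Bm; [exact: S0|exact: SK].
have rK k : (k <= N)%N -> ip mu (OmegaL L) (r k) (r k) <= K3.
  move=> kN; have [t _] := inVk k kN; have [w _] := H2_weak (r k).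
  apply: le_trans (trace_poincare L0 (H2_fun_inL2 _) (H2_ds_inL2 _) w t) _.
  by apply: Bm; [exact: ip_ge0|exact: dsK].
have K20 : 0 <= K2 by exact: B0.
have K30 : 0 <= K3 by exact: B0.
have Com : 0 <= C / omega by rewrite divr_ge0 ?(ltW om0).
split.
- move=> k kN; rewrite -/(a k); apply: (@le_trans _ _ (C / omega)); last lra.
  rewrite ler_pdivlMr// mulrC; have := E k kN.
  by have := bS k; have := bQ k; lra.
- move=> k kN; have := SK k kN; have := dsK k kN; have := rK k kN; rewrite /S.
  by split; lra.
- apply: (@le_trans _ _ K1); last lra.
  (* The first increment vanishes because r_0 = r_1; after the shift the others are the terms
     [Q k.+1], 1 <= k < N, of the energy inequality at m = N. *)
  rewrite big_ltn// -/(Q 1%N) Q10 add0r big_add1/=.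
  rewrite ler_pdivlMr// mulrC; have /E : (1 <= N <= N)%N by rewrite N0/=.
  by have := oa N; have := bS N; lra.
Qed.

End UniformBounds.

(** * Weak derivatives on a rectangle *)

Section Plane.
Variable R : realType.
Notation RR := (measurableTypeR R * measurableTypeR R)%type.

(** The measurable sets here are those of the product sigma-algebra, while continuity speaks of open
    sets; an open set is the countable union of the boxes with rational corners that it contains. *)
Lemma open_measurable_plane (U : set (R * R)) : open U -> measurable (U : set RR).
Proof.
move=> oU.
pose box (q : rat * rat * rat * rat) : set (R * R) :=
  `]ratr q.1.1.1, ratr q.1.1.2[ `*` `]ratr q.1.2, ratr q.2[.
pose F q := if pselect (box q `<=` U) then box q else set0.
have -> : U = \bigcup_q F q.
  apply/seteqP; split => [[x y] Uxy|z [q _]]; last first.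
    by rewrite /F; case: pselect => // qU /qU.
  have [[A B] /= [xA yB] ABU] : nbhs (x, y) U by exact: open_nbhs_nbhs.
  have [e /= e0 eA] := (nbhs_ballP _ _).1 xA.
  have [d /= d0 dB] := (nbhs_ballP _ _).1 yB.
  have [q1 q1P] := @rat_in_itvoo R (x - e) x (ltac:(by rewrite ltrBlDr ltrDl)).
  have [q2 q2P] := @rat_in_itvoo R x (x + e) (ltac:(by rewrite ltrDl)).
  have [q3 q3P] := @rat_in_itvoo R (y - d) y (ltac:(by rewrite ltrBlDr ltrDl)).
  have [q4 q4P] := @rat_in_itvoo R y (y + d) (ltac:(by rewrite ltrDl)).
  move: q1P q2P q3P q4P; rewrite !in_itv/= => /andP[? ?] /andP[? ?] /andP[? ?] /andP[? ?].
  have boxU : box (q1, q2, q3, q4) `<=` U.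
    case=> u v [] /=; rewrite !in_itv/= => /andP[? ?] /andP[? ?].
    apply: ABU; split => /=.
      by apply: eA; rewrite /ball/= ltr_distl; apply/andP; split; lra.
    by apply: dB; rewrite /ball/= ltr_distl; apply/andP; split; lra.
  exists (q1, q2, q3, q4) => //; rewrite /F; case: pselect => [?|/(_ boxU)//].
  by split => /=; rewrite in_itv/=; apply/andP.
apply: countable_bigcupT_measurable => // q; rewrite /F; case: pselect => qU //=.
by apply: measurableX; exact: measurable_itv.
Qed.

Lemma continuous_measurable_plane (G : R * R -> R) (D : set RR) : measurable D ->
  continuous G -> measurable_fun D G.
Proof.
move=> mD /continuousP cG; apply: (measurability _ (RGenOpens.measurableE R)).
move=> _ [_ [a [c ->] <-]]; apply: measurableI => //.
by apply: open_measurable_plane; exact/cG/interval_open.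
Qed.

(** Restriction to lines reduces directional derivatives in the plane to derivatives in one
    variable, and so slices of test functions to test functions on an interval. *)
Definition line (p q : R * R) (s : R) : R * R := q + s *: p.

Lemma line_differentiable p q s : differentiable (line p q) s.
Proof. by rewrite /line; apply: differentiableD => //; exact: differentiableZl. Qed.

(** Both sides are limits of the same difference quotient. *)
Lemma derive_line (G : R * R -> R) p q v s :
  'D_v (G \o line p q) s = 'D_(v *: p) G (line p q s).
Proof.
rewrite /derive; set g1 := fun h => h^-1 *: _; set g2 := fun h => h^-1 *: _.
suff -> : g1 = g2 by [].
apply/funext => h; rewrite /g1 /g2 /=; congr (_ *: (G _ - _)).
by rewrite /line addrCA scalerDl scalerA addrC.
Qed.

Lemma iter_derive_line (phi : R * R -> R) p q (vs : seq R) :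
  iter_derive vs (phi \o line p q) =
  iter_derive [seq v *: p | v <- vs] phi \o line p q.
Proof.
elim: vs => [//|v vs IH]; apply/funext => s.
by rewrite /= -/(iter_derive _ _) IH derive_line.
Qed.

(** The closed support of the restriction lies in the preimage of the closed support of phi, hence
    in ]a, c[, and it is compact as a closed subset of [a, c]. *)
Lemma test_function_line (D : set (R * R)) phi p q (a c : R) :
  test_function D phi -> (forall s, D (line p q s) -> a < s < c) ->
  test_function `]a, c[ (phi \o line p q).
Proof.
move=> t Dac; have [d cK KD] := t.
have cl : continuous (line p q).
  by move=> s; apply: differentiable_continuous; exact: line_differentiable.
set K := closure [set x | phi x != 0] in cK KD.
have sub : closure [set s | (phi \o line p q) s != 0] `<=` line p q @^-1` K.
  have cP : closed (line p q @^-1` K).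
    by move/continuous_closedP : cl; apply; exact: closed_closure.
  rewrite [X in _ `<=` X]((closure_id _).1 cP); apply: closure_subset => s /= sn.
  exact: subset_closure.
have subac : closure [set s | (phi \o line p q) s != 0] `<=` `]a, c[.
  by move=> s /sub /KD /Dac; rewrite /= in_itv.
split => //.
- move=> vs s; rewrite iter_derive_line; apply: differentiable_comp.
    exact: line_differentiable.
  exact: d.
- have subc : closure [set s | (phi \o line p q) s != 0] `<=` `[a, c].
    by apply: subset_trans subac _; exact: subset_itv_oo_cc.
  apply: subclosed_compact subc; first exact: closed_closure.
  exact: segment_compact.
Qed.

Lemma line_s (t s : R) : line (1, 0) (0, t) s = (s, t).
Proof. by congr (_, _); rewrite /= ?add0r /GRing.scale/= ?mulr1 ?mulr0 ?addr0. Qed.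

Lemma line_t (t s : R) : line (0, 1) (s, 0) t = (s, t).
Proof. by congr (_, _); rewrite /= ?add0r /GRing.scale/= ?mulr1 ?mulr0 ?addr0. Qed.

Lemma slice_s (L T : R) phi t : test_function (Omega L T) phi ->
  test_function (OmegaL L) (fun s => phi (s, t)).
Proof.
move=> tphi.
have -> : (fun s => phi (s, t)) = phi \o line (1, 0) (0, t).
  by apply/funext => s /=; rewrite line_s.
apply: test_function_line tphi _ => s; rewrite line_s => -[/=].
by rewrite in_itv.
Qed.

Lemma slice_t (L T : R) phi s : test_function (Omega L T) phi ->
  test_function (OmegaL T) (fun t => phi (s, t)).
Proof.
move=> tphi.
have -> : (fun t => phi (s, t)) = phi \o line (0, 1) (s, 0).
  by apply/funext => t /=; rewrite line_t.
apply: test_function_line tphi _ => t; rewrite line_t => -[/= _].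
by rewrite in_itv.
Qed.

Lemma iter_derive_s phi m (s t : R) :
  @iter_derive R (R * R)%type (nseq m (1, 0)) phi (s, t) =
  @iter_derive R R (nseq m 1) (fun s => phi (s, t)) s.
Proof.
have -> : (fun s => phi (s, t)) = phi \o line (1, 0) (0, t).
  by apply/funext => x /=; rewrite line_s.
by rewrite iter_derive_line map_nseq /= scale1r line_s.
Qed.

Lemma iter_derive_t phi m (s t : R) :
  @iter_derive R (R * R)%type (nseq m (0, 1)) phi (s, t) =
  @iter_derive R R (nseq m 1) (fun t => phi (s, t)) t.
Proof.
have -> : (fun t => phi (s, t)) = phi \o line (0, 1) (s, 0).
  by apply/funext => x /=; rewrite line_t.
by rewrite iter_derive_line map_nseq /= scale1r line_t.
Qed.

End Plane.

(** * Fubini's theorem and products of a function of t with a function of s *)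

Section Rectangle.
Variable R : realType.
Variables (L T : R) (L0 : 0 < L) (T0 : 0 < T).
Notation mu := (@leb1 R).
Notation nu := (@leb2 R).
Notation D1 := (OmegaL L).
Notation D2 := (OmegaL T).
Notation Om := (Omega L T).
Notation RR := (measurableTypeR R * measurableTypeR R)%type.

Let mD1 : measurable (D1 : set (measurableTypeR R)) := @mOmegaL R L.
Let mD2 : measurable (D2 : set (measurableTypeR R)) := @mOmegaL R T.

Lemma mOmega : measurable (Om : set RR).
Proof. by apply: measurableX; exact: measurable_itv. Qed.

Lemma mem_Omega (s t : R) : ((s, t) \in Om) = (s \in D1) && (t \in D2).
Proof. by rewrite /Omega in_setX. Qed.

Lemma measurable_fst_Omega (p : R -> R) : measurable_fun D1 p ->
  measurable_fun Om (fun z => p z.1).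
Proof.
move=> mp; apply: (measurable_comp mD1 _ mp); first by move=> _ [z [? ?] <-].
exact: measurable_funTS measurable_fst.
Qed.

Lemma measurable_snd_Omega (q : R -> R) : measurable_fun D2 q ->
  measurable_fun Om (fun z => q z.2).
Proof.
move=> mq; apply: (measurable_comp mD2 _ mq); first by move=> _ [z [? ?] <-].
exact: measurable_funTS measurable_snd.
Qed.

(** Extension by 0 moves the integral to the whole product space, where Tonelli's theorem
    applies. *)
Lemma tonelli_prod (p q : R -> R) : measurable_fun D1 p -> measurable_fun D2 q ->
  (forall s, D1 s -> 0 <= p s) -> (forall t, D2 t -> 0 <= q t) ->
  (\int[nu]_(z in Om) (p z.1 * q z.2)%:E =
   \int[mu]_(s in D1) (p s)%:E * \int[mu]_(t in D2) (q t)%:E)%E.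
Proof.
move=> mp mq p0 q0.
have Mp : measurable_fun setT (p \_ D1) by exact/(measurable_restrictT _ mD1).
have Mq : measurable_fun setT (q \_ D2) by exact/(measurable_restrictT _ mD2).
have P0 s : 0 <= (p \_ D1) s.
  by rewrite patchE; case: ifPn => // /set_mem; exact: p0.
have Q0 t : 0 <= (q \_ D2) t.
  by rewrite patchE; case: ifPn => // /set_mem; exact: q0.
rewrite integral_mkcond.
have -> : ((fun z : R * R => (p z.1 * q z.2)%:E) \_ Om) =
    (fun z : RR => ((p \_ D1) z.1 * (q \_ D2) z.2)%:E).
  apply/funext => -[s t]; rewrite !patchE mem_Omega /=.
  by case: (s \in D1); case: (t \in D2); rewrite /= ?mulr0 ?mul0r.
have mf : measurable_fun setT (fun z : RR => ((p \_ D1) z.1 * (q \_ D2) z.2)%:E).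
  apply/measurable_EFinP; apply: measurable_funM.
    exact: (measurableT_comp Mp measurable_fst).
  exact: (measurableT_comp Mq measurable_snd).
rewrite /leb2 fubini_tonelli1//; last by move=> z; rewrite lee_fin mulr_ge0.
have iq : (\int[mu]_t ((q \_ D2) t)%:E = \int[mu]_(t in D2) (q t)%:E)%E.
  by rewrite [RHS]integral_mkcond restrict_EFin.
have ip : (\int[mu]_s ((p \_ D1) s)%:E = \int[mu]_(s in D1) (p s)%:E)%E.
  by rewrite [RHS]integral_mkcond restrict_EFin.
rewrite -ip -iq /fubini_F.
transitivity (\int[mu]_s (((p \_ D1) s)%:E * \int[mu]_t ((q \_ D2) t)%:E))%E.
  apply: eq_integral => s _ /=; under eq_integral do rewrite EFinM.
  rewrite ge0_integralZl//; first exact/measurable_EFinP.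
  - by move=> t _; rewrite lee_fin.
  - by rewrite lee_fin.
rewrite ge0_integralZr//; first exact/measurable_EFinP.
- by move=> s _; rewrite lee_fin.
- by apply: integral_ge0 => t _; rewrite lee_fin.
Qed.

(** Both orders are used: derivatives in s are transferred on slices of fixed t, derivatives in t on
    slices of fixed s. *)
Lemma fubini_Omega (K : R * R -> R) : nu.-integrable Om (EFin \o K) ->
  (\int[nu]_(z in Om) (K z)%:E = \int[mu]_(s in D1) \int[mu]_(t in D2) (K (s, t))%:E)%E /\
  (\int[nu]_(z in Om) (K z)%:E = \int[mu]_(t in D2) \int[mu]_(s in D1) (K (s, t))%:E)%E.
Proof.
move=> iK.
have iT : nu.-integrable setT ((EFin \o K) \_ Om) by exact/(integrable_mkcond _ mOmega).
split.
- rewrite integral_mkcond -(integral12_prod_meas1 iT) [RHS]integral_mkcond.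
  apply: eq_integral => s _; rewrite /fubini_F [RHS]patchE.
  case: ifPn => sD.
    rewrite [RHS]integral_mkcond; apply: eq_integral => t _.
    by rewrite !patchE mem_Omega sD.
  by apply: integral0_eq => t _; rewrite patchE mem_Omega (negbTE sD).
- rewrite integral_mkcond -(integral21_prod_meas1 iT) [RHS]integral_mkcond.
  apply: eq_integral => t _; rewrite /fubini_G [RHS]patchE.
  case: ifPn => tD.
    rewrite [RHS]integral_mkcond; apply: eq_integral => s _.
    by rewrite !patchE mem_Omega tD andbT.
  by apply: integral0_eq => s _; rewrite patchE mem_Omega (negbTE tD) andbF.
Qed.

Lemma integrable_sep (p h : R -> R) (B : R) : mu.-integrable D1 (EFin \o p) ->
  measurable_fun D2 h -> (forall t, `|h t| <= B) ->
  nu.-integrable Om (EFin \o (fun z => p z.1 * h z.2)).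
Proof.
move=> ip mh hB.
have mp : measurable_fun D1 p by apply/measurable_EFinP; exact: (measurable_int mu).
apply/integrableP; split.
  apply/measurable_EFinP; apply: measurable_funM.
    exact: measurable_fst_Omega.
  exact: measurable_snd_Omega.
have -> : (fun z : RR => `|(EFin \o (fun z : RR => (p z.1 * h z.2)%R)) z|%E) =
    (fun z : RR => (`|p z.1| * `|h z.2|)%:E).
  by apply/funext => z /=; rewrite normrM.
have mnp : measurable_fun D1 (fun s => `|p s|) by exact: measurableT_comp.
have mnh : measurable_fun D2 (fun t => `|h t|) by exact: measurableT_comp.
rewrite (tonelli_prod mnp mnh)//.
have ih : mu.-integrable D2 (EFin \o h).
  apply: measurable_bounded_integrable => //; first exact: OmegaL_fin.
  exists B; split; first exact: num_real.
  by move=> M BM x _ /=; rewrite (le_trans (hB x))// ltW.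
have := integrable_norm ip; have := integrable_norm ih.
move=> /(integrable_fin_num mD2) f1 /(integrable_fin_num mD1) f2.
by rewrite -ge0_fin_numE ?fin_numM// mule_ge0// integral_ge0.
Qed.

Lemma Rintegral_sep (p h : R -> R) : mu.-integrable D1 (EFin \o p) ->
  mu.-integrable D2 (EFin \o h) ->
  (forall s, D1 s -> 0 <= p s) -> (forall t, D2 t -> 0 <= h t) ->
  \int[nu]_(z in Om) (p z.1 * h z.2) =
  (\int[mu]_(s in D1) p s) * (\int[mu]_(t in D2) h t).
Proof.
move=> ip ih p0 h0; rewrite /Rintegral tonelli_prod//.
- by rewrite fineM// integrable_fin_num.
- by apply/measurable_EFinP; exact: (measurable_int mu).
- by apply/measurable_EFinP; exact: (measurable_int mu).
Qed.

Lemma nu_Omega_fin : (nu Om < +oo)%E.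
Proof.
have -> : nu Om = (mu D1 * mu D2)%E by exact: product_measure1E.
by rewrite !mu_OmegaL// -EFinM ltry.
Qed.

Definition sep (h : R -> R) (u : R -> 'rV[R]_3) (z : R * R) : 'rV[R]_3 := h z.2 *: u z.1.

Lemma sep_inL2 (h : R -> R) (u : R -> 'rV[R]_3) (B : R) :
  measurable_fun D2 h -> (forall t, `|h t| <= B) ->
  inL2 mu D1 u -> inL2 nu Om (sep h u).
Proof.
move=> mh hB u2; apply: inL2P.
  move=> i; rewrite /sep; under eq_fun do rewrite mxE.
  apply: measurable_funM; first exact: measurable_snd_Omega.
  exact: (@measurable_fst_Omega (fun s => u s 0 i) (u2.1 i)).
have hB2 t : `|h t ^+ 2| <= B ^+ 2.
  by rewrite normrX ler_sqr ?nnegrE ?(le_trans _ (hB t)).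
have mh2 : measurable_fun D2 (fun t => h t ^+ 2) by exact: measurable_funX.
have := integrable_sep (integrable_dotvv u2) mh2 hB2.
apply: eq_integrable; first exact: mOmega.
by move=> z _; rewrite /sep /= dotvZl dotvZr; congr (_%:E); ring.
Qed.

Lemma integrable_coord2_test (u : R * R -> 'rV[R]_3) i phi (vs : seq (R * R)) :
  inL2 nu Om u -> test_function Om phi ->
  nu.-integrable Om (EFin \o (fun z => u z 0 i * iter_derive vs phi z)).
Proof.
move=> u2 t; have [M _ bM] := iter_derive_bounded t vs.
have -> : (EFin \o (fun z => u z 0 i * iter_derive vs phi z)) =
    ((EFin \o iter_derive vs phi) \* (fun z => (u z 0 i)%:E))%E.
  by apply/funext => x /=; rewrite mulrC.
apply: integrableMr.
- exact: mOmega.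
- apply: continuous_measurable_plane; first exact: mOmega.
  exact: (iter_derive_continuous t).
- exists M; split; first exact: num_real.
  by move=> N MN x _ /=; rewrite (le_trans (bM x))// ltW.
- by apply: inL2_integrable_coord => //; [exact: mOmega|exact: nu_Omega_fin].
Qed.

(** On a slice of fixed t, phi is a test function in s and [h t] a constant factor, so the
    one-dimensional identity for [u] applies under the outer integral. *)
Lemma sep_weak_s m (h : R -> R) (u g : R -> 'rV[R]_3) (B : R) :
  measurable_fun D2 h -> (forall t, `|h t| <= B) ->
  inL2 mu D1 u -> inL2 mu D1 g -> weak_deriv1 L m u g ->
  weak_deriv2 L T m 0 (sep h u) (sep h g).
Proof.
move=> mh hB u2 g2 /weak_deriv1P w phi t i; rewrite /= cats0 addn0.
have {}w := w L0 u2 g2.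
have iu := integrable_coord2_test i (nseq m (1, 0)) (sep_inL2 mh hB u2) t.
have ig := integrable_coord2_test i [::] (sep_inL2 mh hB g2) t.
rewrite (fubini_Omega iu).2 -integralZl//; last exact: mOmega.
have ig' : nu.-integrable Om (EFin \o (fun z => (-1) ^+ m * (sep h g z 0 i * phi z))).
  by have := integrableZl mOmega ((-1) ^+ m) ig; apply: eq_integrable => //; exact: mOmega.
rewrite [RHS](_ : _ = \int[nu]_(z in Om) ((-1) ^+ m * (sep h g z 0 i * phi z))%:E)%E//.
rewrite (fubini_Omega ig').2; apply: eq_integral => y _.
have ty := slice_s y t.
have i1 := integrable_coord_test L0 i (nseq m (1 : R)) u2 ty.
have i2 := integrable_coord_test L0 i [::] g2 ty.
have Z (c : R) (k : R -> R) : mu.-integrable D1 (EFin \o k) ->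
    (\int[mu]_(s in D1) (c * k s)%:E = (c * \int[mu]_(s in D1) k s)%:E)%E.
  move=> ik; rewrite -RintegralZl// Rintegral_eq_EFin//.
  by have := integrableZl mD1 c ik; exact: eq_integrable.
transitivity ((h y * \int[mu]_(s in D1)
   (u s 0 i * @iter_derive R R (nseq m 1) (fun s => phi (s, y)) s))%:E)%E.
  rewrite -(Z _ _ i1); apply: eq_integral => s _.
  by rewrite iter_derive_s /sep mxE /=; congr (_%:E); ring.
rewrite w// mulrCA mulrA; apply: etrans (esym (Z _ _ i2)) _.
by apply: eq_integral => s _; rewrite /sep mxE /=; congr (_%:E); ring.
Qed.

Definition weak_t (h h' : R -> R) := forall psi, test_function D2 psi ->
  \int[mu]_(t in D2) (h t * 'D_1 psi t) = - \int[mu]_(t in D2) (h' t * psi t).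

Lemma integrable_test (h : R -> R) B psi (vs : seq R) : measurable_fun D2 h ->
  (forall t, D2 t -> `|h t| <= B) -> test_function D2 psi ->
  mu.-integrable D2 (EFin \o (fun t => h t * iter_derive vs psi t)).
Proof.
move=> mh hB t; have [M _ bM] := iter_derive_bounded t vs.
apply: (integrable_Mbounded (M := M)) => //.
  by apply: continuous_measurable; exact: (iter_derive_continuous t).
apply: measurable_bounded_integrable => //; first exact: OmegaL_fin.
exists B; split; first exact: num_real.
by move=> N MN x Dx /=; rewrite (le_trans (hB x Dx))// ltW.
Qed.

Lemma sep_weak_t (h h' : R -> R) (u : R -> 'rV[R]_3) (B B' : R) :
  measurable_fun D2 h -> (forall t, `|h t| <= B) ->
  measurable_fun D2 h' -> (forall t, `|h' t| <= B') ->
  inL2 mu D1 u -> weak_t h h' ->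
  weak_deriv2 L T 0 1 (sep h u) (sep h' u).
Proof.
move=> mh hB mh' hB' u2 w phi t i; rewrite /= add0n expr1.
have iu := integrable_coord2_test i (nseq 1 (0, 1)) (sep_inL2 mh hB u2) t.
have ig := integrable_coord2_test i [::] (sep_inL2 mh' hB' u2) t.
rewrite (fubini_Omega iu).1 -integralZl//; last exact: mOmega.
have ig' : nu.-integrable Om (EFin \o (fun z => -1 * (sep h' u z 0 i * phi z))).
  by have := integrableZl mOmega (-1) ig; apply: eq_integrable => //; exact: mOmega.
rewrite [RHS](_ : _ = \int[nu]_(z in Om) (-1 * (sep h' u z 0 i * phi z))%:E)%E//.
rewrite (fubini_Omega ig').1; apply: eq_integral => x _.
have tx := slice_t x t.
have i1 := integrable_test [:: (1 : R)] mh (fun t _ => hB t) tx.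
have i2 := integrable_test [::] mh' (fun t _ => hB' t) tx.
have Z (c : R) (k : R -> R) : mu.-integrable D2 (EFin \o k) ->
    (\int[mu]_(s in D2) (c * k s)%:E = (c * \int[mu]_(s in D2) k s)%:E)%E.
  move=> ik; rewrite -RintegralZl// Rintegral_eq_EFin//.
  by have := integrableZl mD2 c ik; exact: eq_integrable.
transitivity ((u x 0 i * \int[mu]_(t in D2)
   (h t * 'D_1 (fun t => phi (x, t)) t))%:E)%E.
  rewrite -(Z _ _ i1); apply: eq_integral => s _.
  have := iter_derive_t phi 1 x s => /= ->.
  by rewrite /sep mxE /=; congr (_%:E); ring.
rewrite w// mulrN -mulN1r mulrA; apply: etrans (esym (Z _ _ i2)) _.
by apply: eq_integral => s _; rewrite /sep mxE /=; congr (_%:E); ring.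
Qed.

Lemma weak_deriv2_eq m n (u u' g g' : R * R -> 'rV[R]_3) :
  (forall z, Om z -> u z = u' z) -> (forall z, Om z -> g z = g' z) ->
  weak_deriv2 L T m n u g -> weak_deriv2 L T m n u' g'.
Proof.
move=> uu gg w phi t i.
have E (v v' : R * R -> 'rV[R]_3) (q : R * R -> R) : (forall z, Om z -> v z = v' z) ->
    (\int[nu]_(z in Om) (v z 0 i * q z)%:E = \int[nu]_(z in Om) (v' z 0 i * q z)%:E)%E.
  by move=> vv; apply: eq_integral => z /set_mem Oz; rewrite vv.
by rewrite -(E _ _ _ uu) -(E _ _ _ gg); exact: w.
Qed.

Lemma weak_deriv2D m n (u v gu gv : R * R -> 'rV[R]_3) :
  inL2 nu Om u -> inL2 nu Om v -> inL2 nu Om gu -> inL2 nu Om gv ->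
  weak_deriv2 L T m n u gu -> weak_deriv2 L T m n v gv ->
  weak_deriv2 L T m n (fun z => u z + v z) (fun z => gu z + gv z).
Proof.
move=> u2 v2 gu2 gv2 wu wv phi t i.
have A (a c : R * R -> 'rV[R]_3) vs : inL2 nu Om a -> inL2 nu Om c ->
    (\int[nu]_(z in Om) ((a z + c z) 0 i * iter_derive vs phi z)%:E =
     \int[nu]_(z in Om) (a z 0 i * iter_derive vs phi z)%:E +
     \int[nu]_(z in Om) (c z 0 i * iter_derive vs phi z)%:E)%E.
  move=> a2 c2; have ia := integrable_coord2_test i vs a2 t.
  have ic := integrable_coord2_test i vs c2 t.
  rewrite -integralD//; last exact: mOmega.
  by apply: eq_integral => z _; rewrite mxE mulrDl EFinD.
have f1 := integrable_fin_num mOmega (integrable_coord2_test i [::] gu2 t).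
rewrite A// wu// wv//; apply: etrans (esym (muleDr _ _)) _ => //.
  exact: fin_num_adde_defr.
by congr (_ * _)%E; exact: (esym (A gu gv [::] gu2 gv2)).
Qed.

Lemma inL2_sum (s : seq nat) (U : nat -> R * R -> 'rV[R]_3) :
  (forall k, inL2 nu Om (U k)) -> inL2 nu Om (fun z => \sum_(k <- s) U k z).
Proof.
move=> U2; elim: s => [|k s IH].
  have := inL2Z mOmega 0 (U2 0%N); congr (inL2 _ _ _).
  by apply/funext => z; rewrite big_nil scale0r.
have := inL2_lin mOmega 1 1 (U2 k) IH; congr (inL2 _ _ _).
by apply/funext => z; rewrite big_cons !scale1r.
Qed.

Lemma weak_deriv2_sum m n (s : seq nat) (U G : nat -> R * R -> 'rV[R]_3) :
  (forall k, inL2 nu Om (U k)) -> (forall k, inL2 nu Om (G k)) ->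
  (forall k, weak_deriv2 L T m n (U k) (G k)) ->
  weak_deriv2 L T m n (fun z => \sum_(k <- s) U k z) (fun z => \sum_(k <- s) G k z).
Proof.
move=> U2 G2 w; elim: s => [|k s IH].
  move=> phi t i.
  by rewrite !integral0_eq ?mule0// => z _; rewrite big_nil mxE mul0r.
apply: (weak_deriv2_eq _ _ (weak_deriv2D (U2 k) (inL2_sum s U2) (G2 k) (inL2_sum s G2) (w k) IH)).
  by move=> z _; rewrite big_cons.
by move=> z _; rewrite big_cons.
Qed.

End Rectangle.

(** * Piecewise linear interpolation in time *)

Section Ramp.
Variable R : realType.
Variables (T : R) (T0 : 0 < T).
Notation mu := (@leb1 R).
Notation D2 := (OmegaL T).

Definition ramp (a t : R) : R := Num.max (t - a) 0.

Lemma ramp_continuous (a : R) : continuous (ramp a).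
Proof.
move=> t; have ct : {for t, continuous (fun t : R => t - a)}.
  by apply: cvgB; [exact: cvg_id|exact: cvg_cst].
by apply: (continuous_max ct); exact: cvg_cst.
Qed.

Lemma measurable_after (a : R) : measurable_fun D2 (fun t : R => (a < t)%R%:R : R).
Proof.
have -> : (fun t : R => (a < t)%R%:R : R) = \1_(`]a, +oo[).
  apply/funext => t; rewrite indicE; congr ((nat_of_bool _)%:R).
  by apply/idP/idP => [at_|/set_mem]; rewrite ?inE /= in_itv/= andbT.
exact: measurable_indic.
Qed.

(** Integrate (t - a) psi by parts on ]a, T[: the boundary term vanishes at a through the factor and
    at T through the support of psi. For a >= T both integrals are over the empty set. *)
Lemma ramp_weak_t (a : R) : 0 <= a -> weak_t T (ramp a) (fun t : R => (a < t)%R%:R).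
Proof.
move=> a0 psi tp.
have cp : continuous psi := iter_derive_continuous tp (vs := [::]).
have cdp : continuous (fun s => 'D_1 psi s) := iter_derive_continuous tp (vs := [:: (1 : R)]).
have DI : D2 `&` `]a, T[%classic = `]a, T[%classic.
  apply/seteqP; split => [t []//|t]; rewrite /OmegaL /= in_itv/= => /andP[at_ tT].
  by rewrite !in_itv/= at_ tT (le_lt_trans a0).
have E1 : \int[mu]_(t in D2) (ramp a t * 'D_1 psi t) =
    \int[mu]_(t in `]a, T[) ((t - a) * 'D_1 psi t).
  rewrite -DI Rintegral_mkcondr; apply: eq_Rintegral => t /set_mem.
  rewrite /OmegaL /= in_itv/= => /andP[t0 tT]; rewrite patchE /ramp.
  case: ifPn => [/set_mem|/negP tn].
    by rewrite /= in_itv/= => /andP[at_ _]; rewrite max_l// subr_ge0 ltW.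
  rewrite max_r ?mul0r// subr_le0 leNgt; apply/negP => at_; apply: tn.
  by apply/mem_set; rewrite /= in_itv/= at_.
have E2 : \int[mu]_(t in D2) ((a < t)%R%:R * psi t) = \int[mu]_(t in `]a, T[) psi t.
  rewrite -DI Rintegral_mkcondr; apply: eq_Rintegral => t /set_mem.
  rewrite /OmegaL /= in_itv/= => /andP[t0 tT]; rewrite patchE.
  case: ifPn => [/set_mem|/negP tn].
    by rewrite /= in_itv/= => /andP[-> _]; rewrite mul1r.
  have [at_|_] := ltP a t; last by rewrite mul0r.
  by case: tn; apply/mem_set; rewrite /= in_itv/= at_.
rewrite E1 E2; have [Ta|aT] := leP T a.
  by rewrite set_itv_ge ?bnd_simp -?leNgt// !Rintegral_set0 oppr0.
have dp x : is_derive x (1 : R) psi ('D_1 psi x).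
  by apply/derivableP/derivable1_diffP; case: tp => /(_ [::] x).
have dF (x : R) : is_derive x (1 : R) (fun s => (s - a) * psi s)
    ((x - a) * 'D_1 psi x + psi x).
  have dL : is_derive x (1 : R) (fun s : R => s - a) 1.
    have dB := is_deriveB (is_derive_id x (1 : R)) (is_derive_cst a x (1 : R)).
    by apply: (is_derive_eq dB); rewrite subr0.
  by apply: (is_derive_eq (is_deriveM dL (dp x))); rewrite /GRing.scale/= mulr1.
have cLp : continuous (fun s => (s - a) * 'D_1 psi s).
  by move=> x; apply: cvgM; [apply: cvgB; [exact: cvg_id|exact: cvg_cst]|exact: cdp].
have cF : continuous (fun s => (s - a) * 'D_1 psi s + psi s).
  by move=> x; apply: cvgD; [exact: cLp|exact: cp].
have := FTC_oo aT dF cF.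
have -> : psi T = 0.
  by apply: (iter_derive_eq0D tp [::]); rewrite /OmegaL /= in_itv/= ltxx andbF.
rewrite mulr0 subrr mul0r subr0 RintegralD//; first by move/eqP; rewrite addr_eq0 => /eqP.
- by apply: integrable_oo_within; exact: continuous_subspaceT.
- by apply: integrable_oo_within; exact: continuous_subspaceT.
Qed.

End Ramp.

(** * The interpolant, its weak derivatives and their norms *)

Section Interpolant.
Variable R : realType.
Variables (L T : R) (L0 : 0 < L) (T0 : 0 < T) (N : nat) (N0 : (0 < N)%N).
Notation mu := (@leb1 R).
Notation nu := (@leb2 R).
Notation D1 := (OmegaL L).
Notation D2 := (OmegaL T).
Notation Om := (Omega L T).
Notation tau := (tau T N).
Notation tk := (tk T N).
Implicit Types (F G : nat -> R -> 'rV[R]_3).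

Let mD1 : measurable (D1 : set (measurableTypeR R)) := @mOmegaL R L.
Let mD2 : measurable (D2 : set (measurableTypeR R)) := @mOmegaL R T.
Let mO : measurable (Om : set (measurableTypeR R * measurableTypeR R)) := @mOmega R L T.

Lemma tau_gt0 : 0 < tau. Proof. by rewrite divr_gt0// ltr0n. Qed.

Lemma tkS k : tk k.+1 = tk k + tau.
Proof. by rewrite /Defs.tk -natr1 mulrDl mul1r. Qed.

Lemma tk_ge0 k : 0 <= tk k. Proof. by rewrite mulr_ge0// ltW// tau_gt0. Qed.

(** Inequalities on both sides, so that k = 0 is included, where [0.-1] is 0 and the slot is
    empty. *)
Lemma tk_pred k : tk k.-1 <= tk k <= tk k.-1 + tau.
Proof. by case: k => [|k]; rewrite /= ?tkS lexx ?lerDl ltW// tau_gt0. Qed.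

Lemma le_tk j k : (j <= k)%N -> tk j <= tk k.
Proof. by move=> jk; rewrite /Defs.tk ler_wpM2r ?ler_nat// ltW// tau_gt0. Qed.

Lemma tkN : tk N = T.
Proof. by rewrite /Defs.tk /Defs.tau mulrCA divff ?mulr1// pnatr_eq0 -lt0n. Qed.

(** The indicator of ]t_{k-1}, t_k], written as a boolean to match the index condition in
    [interpolant]. *)
Definition slot k (t : R) : R := (tk k.-1 < t <= tk k)%R%:R.

Lemma slot_itv k t : 0 <= slot k t <= 1.
Proof. by rewrite /slot; case: (tk k.-1 < t <= tk k); rewrite ?lexx ?ler01. Qed.

Lemma slot_indic k : slot k = \1_(`]tk k.-1, tk k]).
Proof.
by apply/funext => t; rewrite /slot indicE mem_setE in_itv.
Qed.

Lemma measurable_slot k : measurable_fun D2 (slot k).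
Proof. by rewrite slot_indic; exact: measurable_indic. Qed.

Lemma slot_bound k t : `|slot k t| <= 1.
Proof. by have /andP[s0 s1] := slot_itv k t; rewrite ger0_norm. Qed.

Lemma integrable_slot k : mu.-integrable D2 (EFin \o slot k).
Proof.
apply: measurable_bounded_integrable => //; [exact: OmegaL_fin|exact: measurable_slot|].
exists 1; split; first exact: num_real.
by move=> M M1 t _ /=; rewrite (le_trans (slot_bound k t))// ltW.
Qed.

Lemma Rintegral_slot k : \int[mu]_(t in D2) slot k t <= tau.
Proof.
rewrite /Rintegral slot_indic integral_indic//.
have m1 : measurable (`]tk k.-1, tk k] : set (measurableTypeR R)) by exact: measurable_itv.
have le1 : (mu (`]tk k.-1, tk k]%classic `&` D2) <= mu `]tk k.-1, tk k]%classic)%E.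
  by apply: le_measure; rewrite ?inE//; exact: measurableI.
have le2 : (mu `]tk k.-1, tk k]%classic <= tau%:E)%E.
  have -> : mu `]tk k.-1, tk k]%classic = lebesgue_measure (`]tk k.-1, tk k]%classic : set R) by [].
  rewrite lebesgue_measure_itv/=; have /andP[_ tt] := tk_pred k.
  case: ifP => _; first by rewrite -EFinB lee_fin lerBlDl.
  by rewrite lee_fin ltW// tau_gt0.
rewrite -lee_fin fineK ?(le_trans le1)// ge0_fin_numE//.
by rewrite (le_lt_trans le1)// (le_lt_trans le2)// ltry.
Qed.

(** [j] is the least index with t <= t_j: it is at most N as t < T = t_N, and positive as t > 0 =
    t_0. *)
Lemma slot_select t : D2 t -> exists2 j, (1 <= j <= N)%N /\ tk j.-1 < t <= tk j &
  forall k, (1 <= k)%N -> (tk k.-1 < t <= tk k) = (k == j).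
Proof.
rewrite /OmegaL /= in_itv/= => /andP[t0 tT].
have exN : exists j, t <= tk j by exists N; rewrite tkN ltW.
have [j tj jmin] := ex_minnP exN.
have j1 : (0 < j)%N.
  by rewrite lt0n; apply/eqP => j0; move: tj; rewrite j0 /Defs.tk mul0r leNgt t0.
have jN : (j <= N)%N by apply: jmin; rewrite tkN ltW.
have jp : tk j.-1 < t.
  by rewrite ltNge; apply/negP => /jmin; rewrite leqNgt prednK// leqnn.
exists j; first by rewrite j1 jN jp.
move=> k k1; apply/idP/eqP => [/andP[kt tk']|->]; last by rewrite jp.
apply/eqP; rewrite eqn_leq jmin// andbT leqNgt; apply/negP => jk.
have : tk j <= tk k.-1 by apply: le_tk; rewrite -ltnS prednK.
by move=> jk'; move: (lt_le_trans kt (le_trans tj jk')); rewrite ltxx.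
Qed.

Lemma sum_slot (V : lmodType R) (X : nat -> V) t j : (1 <= j <= N)%N ->
  (forall k, (1 <= k)%N -> (tk k.-1 < t <= tk k) = (k == j)) ->
  \sum_(k <- index_iota 1 N.+1) slot k t *: X k = X j.
Proof.
move=> jN sel; rewrite (bigD1_seq j) ?iota_uniq ?mem_index_iota//=.
rewrite {1}/slot sel ?eqxx ?scale1r; last by case/andP: jN.
rewrite big_seq_cond big1 ?addr0// => k; rewrite mem_index_iota => /andP[/andP[k1 _] kj].
by rewrite /slot sel// (negbTE kj) scale0r.
Qed.

(** [interpolant] for an arbitrary family, so that the same lemmas serve r_k and both of its
    derivatives in s; at F = r the two are convertible. *)
Definition pw F (z : R * R) : 'rV[R]_3 :=
  \sum_(1 <= k < N.+1 | tk k.-1 < z.2 <= tk k)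
    (((z.2 - tk k.-1) / tau) *: (F k z.1 - F k.-1 z.1) + F k.-1 z.1).

Definition dpw F (z : R * R) : 'rV[R]_3 :=
  \sum_(k <- index_iota 1 N.+1)
    sep (fun t => tau^-1 * slot k t) (fun s => F k s - F k.-1 s) z.

Let frac k (t : R) : R := (t - tk k.-1) / tau * slot k t.

Let pwE F : pw F = fun z => \sum_(k <- index_iota 1 N.+1)
  (sep (frac k) (fun s => F k s - F k.-1 s) z + sep (slot k) (F k.-1) z).
Proof.
apply/funext => z; rewrite /pw big_mkcond/=; apply: eq_bigr => k _.
rewrite /sep /frac /slot; case: ifP => _; first by rewrite mulr1 scale1r.
by rewrite mulr0 !scale0r addr0.
Qed.

Let pw_at F z j : (1 <= j <= N)%N ->
  (forall k, (1 <= k)%N -> (tk k.-1 < z.2 <= tk k) = (k == j)) ->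
  pw F z = ((z.2 - tk j.-1) / tau) *: (F j z.1 - F j.-1 z.1) + F j.-1 z.1.
Proof.
move=> jN sel; rewrite pwE /sep -(sum_slot (fun k =>
  ((z.2 - tk k.-1) / tau) *: (F k z.1 - F k.-1 z.1) + F k.-1 z.1) jN sel).
by apply: eq_bigr => k _; rewrite [RHS]scalerDr scalerA /frac [in LHS]mulrC.
Qed.

Let frac_bound k t : `|frac k t| <= 1.
Proof.
rewrite /frac /slot; have [/andP[kt tk']|_] := boolP (tk k.-1 < t <= tk k); last first.
  by rewrite mulr0 normr0.
have /andP[_ tt] := tk_pred k; have t0 := tau_gt0.
have d0 : 0 <= t - tk k.-1 by rewrite subr_ge0 ltW.
rewrite mulr1 ger0_norm; last by rewrite divr_ge0// ltW.
by rewrite ler_pdivrMr// mul1r lerBlDl (le_trans tk').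
Qed.

Let measurable_frac k : measurable_fun D2 (frac k).
Proof.
apply: measurable_funM; last exact: measurable_slot.
apply: continuous_measurable => t; apply: cvgM; last exact: cvg_cst.
by apply: cvgB; [exact: cvg_id|exact: cvg_cst].
Qed.

Let inL2_diff F k : (forall k, inL2 mu D1 (F k)) -> inL2 mu D1 (fun s => F k s - F k.-1 s).
Proof. by move=> F2; exact: inL2B. Qed.

Let term_inL2 F k : (forall k, inL2 mu D1 (F k)) ->
  inL2 nu Om (fun z => sep (frac k) (fun s => F k s - F k.-1 s) z + sep (slot k) (F k.-1) z).
Proof.
move=> F2.
have i1 : inL2 nu Om (sep (frac k) (fun s => F k s - F k.-1 s)).
  exact: (sep_inL2 T0 (measurable_frac k) (frac_bound k) (inL2_diff k F2)).
have i2 : inL2 nu Om (sep (slot k) (F k.-1)).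
  exact: (sep_inL2 T0 (measurable_slot k) (slot_bound k)).
have := inL2_lin mO 1 1 i1 i2; congr (inL2 _ _ _).
by apply/funext => z; rewrite !scale1r.
Qed.

Lemma pw_inL2 F : (forall k, inL2 mu D1 (F k)) -> inL2 nu Om (pw F).
Proof.
move=> F2; rewrite pwE.
exact: (inL2_sum _ (fun k => term_inL2 k F2)).
Qed.

Let weak_diff m F G k : (forall k, inL2 mu D1 (F k)) -> (forall k, inL2 mu D1 (G k)) ->
  (forall k, weak_deriv1 L m (F k) (G k)) ->
  weak_deriv1 L m (fun s => F k s - F k.-1 s) (fun s => G k s - G k.-1 s).
Proof.
move=> F2 G2 w.
have := weak_deriv1_lin L0 1 (-1) (F2 k) (F2 k.-1) (G2 k) (G2 k.-1) (w k) (w k.-1).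
by congr (weak_deriv1 _ _ _ _); apply/funext => s; rewrite scale1r scaleN1r.
Qed.

Lemma pw_weak_s m F G : (forall k, inL2 mu D1 (F k)) -> (forall k, inL2 mu D1 (G k)) ->
  (forall k, weak_deriv1 L m (F k) (G k)) -> weak_deriv2 L T m 0 (pw F) (pw G).
Proof.
move=> F2 G2 w; rewrite !pwE.
apply: (weak_deriv2_sum L0 T0 _ (fun k => term_inL2 k F2) (fun k => term_inL2 k G2)) => k.
apply: (weak_deriv2D L0 T0).
- exact: (sep_inL2 T0 (measurable_frac k) (frac_bound k) (inL2_diff k F2)).
- exact: (sep_inL2 T0 (measurable_slot k) (slot_bound k)).
- exact: (sep_inL2 T0 (measurable_frac k) (frac_bound k) (inL2_diff k G2)).
- exact: (sep_inL2 T0 (measurable_slot k) (slot_bound k)).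
- apply: (sep_weak_s L0 T0 (measurable_frac k) (frac_bound k)).
  + exact: inL2_diff.
  + exact: inL2_diff.
  + exact: weak_diff.
- exact: (sep_weak_s L0 T0 (measurable_slot k) (slot_bound k)).
Qed.

Let mdslot k : measurable_fun D2 (fun t => tau^-1 * slot k t).
Proof. by apply: measurable_funM => //; exact: measurable_slot. Qed.

Let dslot_bound k t : `|tau^-1 * slot k t| <= tau^-1.
Proof.
have ti : 0 < tau^-1 by rewrite invr_gt0 tau_gt0.
by rewrite normrM gtr0_norm// ler_piMr ?slot_bound// ltW.
Qed.

Lemma dpw_inL2 F : (forall k, inL2 mu D1 (F k)) -> inL2 nu Om (dpw F).
Proof.
move=> F2; apply: inL2_sum => k.
exact: (sep_inL2 T0 (mdslot k) (dslot_bound k) (inL2_diff k F2)).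
Qed.

Lemma dpw_weak_s m F G : (forall k, inL2 mu D1 (F k)) -> (forall k, inL2 mu D1 (G k)) ->
  (forall k, weak_deriv1 L m (F k) (G k)) -> weak_deriv2 L T m 0 (dpw F) (dpw G).
Proof.
move=> F2 G2 w; apply: (weak_deriv2_sum L0 T0 _) => k.
- exact: (sep_inL2 T0 (mdslot k) (dslot_bound k) (inL2_diff k F2)).
- exact: (sep_inL2 T0 (mdslot k) (dslot_bound k) (inL2_diff k G2)).
- apply: (sep_weak_s L0 T0 (mdslot k) (dslot_bound k)).
  + exact: inL2_diff.
  + exact: inL2_diff.
  + exact: weak_diff.
Qed.

(** For k >= 1, the continuous function that is 0 before slot k, rises linearly across it and stays
    at 1. As a combination of ramps it has a weak derivative, unlike [frac] and [slot], which
    jump. *)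
Let clamp k (t : R) : R := tau^-1 * (ramp (tk k.-1) t - ramp (tk k) t).

Let clamp_itv k t : 0 <= clamp k t <= 1.
Proof.
have t0 := tau_gt0; have /andP[t1 t2] := tk_pred k.
rewrite /clamp pmulr_rge0 ?invr_gt0// mulrC ler_pdivrMr// mul1r /ramp.
by case: (leP (t - tk k.-1) 0) => ?; case: (leP (t - tk k) 0) => ?; apply/andP; split; lra.
Qed.

Let clamp_bound k t : `|clamp k t| <= 1.
Proof. by have /andP[c0 c1] := clamp_itv k t; rewrite ger0_norm. Qed.

Let measurable_clamp k : measurable_fun D2 (clamp k).
Proof.
apply: measurable_funM => //; apply: measurable_funB; apply: continuous_measurable;
  exact: ramp_continuous.
Qed.

Let clamp_weak k : weak_t T (clamp k) (fun t => tau^-1 * slot k t).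
Proof.
move=> psi tp.
have bramp a t : 0 <= a -> D2 t -> `|ramp a t| <= T.
  rewrite /OmegaL /= in_itv/= /ramp => a0 /andP[t0 tT].
  by case: (leP (t - a) 0) => ta; rewrite ?normr0 ?(ltW T0)// gtr0_norm//; lra.
have mr a : measurable_fun D2 (ramp a).
  by apply: continuous_measurable; exact: ramp_continuous.
have ir a : 0 <= a -> mu.-integrable D2 (EFin \o (fun t => ramp a t * 'D_1 psi t)).
  move=> a0.
  by have := integrable_test T0 [:: (1 : R)] (mr a) (fun t => bramp a t a0) tp.
have ia a : mu.-integrable D2 (EFin \o (fun t => (a < t)%R%:R * psi t)).
  apply: (integrable_test (B := 1) T0 [::] (@measurable_after R T a) _ tp) => t _.
  by case: (a < t); rewrite ?normr1 ?normr0.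
have iB p q : mu.-integrable D2 (EFin \o p) -> mu.-integrable D2 (EFin \o q) ->
    mu.-integrable D2 (EFin \o (fun t => p t - q t)) by exact: integrableB.
have E p q r (c : R) : mu.-integrable D2 (EFin \o (fun t => p t * r t)) ->
    mu.-integrable D2 (EFin \o (fun t => q t * r t)) ->
    \int[mu]_(t in D2) (c * (p t - q t) * r t) =
    c * (\int[mu]_(t in D2) (p t * r t) - \int[mu]_(t in D2) (q t * r t)).
  move=> ip iq; rewrite -RintegralB// -RintegralZl//; last exact: iB.
  by apply: eq_Rintegral => t _; ring.
rewrite /clamp E; [|exact/ir/tk_ge0|exact/ir/tk_ge0].
rewrite !ramp_weak_t ?tk_ge0//.
(* A slot is the difference of two half-lines, whose indicators are the weak derivatives of the two
   ramps. *)
have -> : \int[mu]_(t in D2) (tau^-1 * slot k t * psi t) =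
    \int[mu]_(t in D2) (tau^-1 * ((tk k.-1 < t)%R%:R - (tk k < t)%R%:R) * psi t).
  apply: eq_Rintegral => t _; congr (_ * _ * _); rewrite /slot.
  have /andP[t1 _] := tk_pred k.
  case: (ltP (tk k.-1) t) => h1; case: (leP t (tk k)) => h2 /=; rewrite ?subr0 ?subrr//.
  by move: (lt_le_trans (le_lt_trans t1 h2) h1); rewrite ltxx.
by rewrite E//; ring.
Qed.

(** At a time in slot j, the increments before j have weight 1 and telescope to F_{j-1} - F_0, those
    after j have weight 0, and the j-th has the interpolation weight. *)
Let pw_clamp F z : Om z -> pw F z =
  sep (fun=> 1) (F 0%N) z +
  \sum_(k <- index_iota 1 N.+1) sep (clamp k) (fun s => F k s - F k.-1 s) z.
Proof.
move=> [_ /= z2]; have [j [/andP[j1 jN] /andP[tj jt]] sel] := slot_select z2.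
have tau0 := tau_gt0.
rewrite (pw_at _ _ sel) ?j1// /sep scale1r.
have Z : \sum_(j.+1 <= k < N.+1) clamp k z.2 *: (F k z.1 - F k.-1 z.1) = 0.
  rewrite big_nat_cond big1// => k /andP[/andP[jk _] _].
  have jk' : tk j <= tk k.-1 by apply: le_tk; rewrite -ltnS prednK// (leq_trans _ jk).
  have /andP[t1 _] := tk_pred k.
  have p1 : z.2 - tk k.-1 <= 0 by rewrite subr_le0 (le_trans jt).
  have p2 : z.2 - tk k <= 0 by rewrite subr_le0 (le_trans jt)// (le_trans jk').
  by rewrite /clamp /ramp (max_r p1) (max_r p2) subrr mulr0 scale0r.
have -> : \sum_(k <- index_iota 1 N.+1) clamp k z.2 *: (F k z.1 - F k.-1 z.1) =
    \sum_(1 <= k < j) clamp k z.2 *: (F k z.1 - F k.-1 z.1) +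
    clamp j z.2 *: (F j z.1 - F j.-1 z.1).
  rewrite (@big_cat_nat _ _ _ j)//=; last exact: leqW.
  by rewrite [X in _ + X]big_ltn ?ltnS// Z addr0.
have -> : \sum_(1 <= k < j) clamp k z.2 *: (F k z.1 - F k.-1 z.1) = F j.-1 z.1 - F 0%N z.1.
  transitivity (\sum_(0 <= k < j.-1) (F k.+1 z.1 - F k z.1)); last first.
    exact: (telescope_sumr (fun k => F k z.1)).
  rewrite -{1}(prednK j1) big_add1; apply: eq_big_nat => k /andP[_ kj].
  have kt : tk k.+1 <= z.2.
    by rewrite (le_trans _ (ltW tj))//; apply: le_tk.
  have /andP[t1 _] := tk_pred k.+1.
  rewrite /clamp /ramp !max_l ?subr_ge0 ?(le_trans t1)//= tkS.
  rewrite (_ : z.2 - tk k - (z.2 - (tk k + tau)) = tau); last by ring.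
  by rewrite mulVf ?scale1r// gt_eqF.
rewrite addrA (addrC (F 0%N z.1)) subrK [LHS]addrC; congr (_ + _ *: _).
rewrite /clamp /ramp max_l ?subr_ge0 ?(ltW tj)// max_r ?subr_le0// subr0.
by rewrite mulrC.
Qed.

Lemma pw_weak_t F : (forall k, inL2 mu D1 (F k)) -> weak_deriv2 L T 0 1 (pw F) (dpw F).
Proof.
move=> F2.
have mc (c : R) : measurable_fun D2 (fun=> c) by exact: measurable_cst.
have w0 : weak_t T (fun=> 1) (fun=> 0).
  move=> psi tp.
  have cdp : continuous (fun s => 'D_1 psi s) := iter_derive_continuous tp (vs := [:: (1 : R)]).
  have p0 : psi 0 = 0.
    by apply: (iter_derive_eq0D tp [::]); rewrite /OmegaL /= in_itv/= ltxx.
  have pT : psi T = 0.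
    by apply: (iter_derive_eq0D tp [::]); rewrite /OmegaL /= in_itv/= ltxx andbF.
  under eq_Rintegral do rewrite mul1r.
  under [in RHS]eq_Rintegral do rewrite mul0r.
  rewrite Rintegral_cst// mul0r oppr0 (FTC_OmegaL T0 (F := psi) _ cdp) ?p0 ?pT ?subrr//.
  by move=> x; apply/derivableP/derivable1_diffP; case: tp => /(_ [::] x).
have b1 (t : R) : `|1 : R| <= 1 by rewrite normr1.
have b0 (t : R) : `|0 : R| <= 0 by rewrite normr0.
have s0 := sep_weak_t L0 T0 (mc 1) b1 (mc 0) b0 (F2 0%N) w0.
have i1 := sep_inL2 T0 (mc 1) b1 (F2 0%N).
have i0 := sep_inL2 T0 (mc 0) b0 (F2 0%N).
have ic k := sep_inL2 T0 (measurable_clamp k) (clamp_bound k) (inL2_diff k F2).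
have id k := sep_inL2 T0 (mdslot k) (dslot_bound k) (inL2_diff k F2).
have sk k := sep_weak_t L0 T0 (measurable_clamp k) (clamp_bound k) (mdslot k)
  (dslot_bound k) (inL2_diff k F2) (clamp_weak k).
have ws := weak_deriv2_sum L0 T0 (index_iota 1 N.+1) ic id sk.
have := weak_deriv2D L0 T0 i1 (inL2_sum _ ic) i0 (inL2_sum _ id) s0 ws.
apply: weak_deriv2_eq => z Oz; first by rewrite pw_clamp.
by rewrite /dpw {1}/sep scale0r add0r.
Qed.

(** Every term of the dominating sum separates into a function of s and a slot, and a slot
    contributes at most its length tau. *)
Lemma slot_sum_bound (V : R * R -> 'rV[R]_3) (p : nat -> R -> R) :
  inL2 nu Om V -> (forall k, mu.-integrable D1 (EFin \o p k)) ->
  (forall k s, 0 <= p k s) ->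
  (forall z, Om z -> dotv (V z) (V z) <=
     \sum_(k <- index_iota 1 N.+1) p k z.1 * slot k z.2) ->
  ip nu Om V V <= \sum_(k <- index_iota 1 N.+1) (\int[mu]_(s in D1) p k s) * tau.
Proof.
move=> V2 ipk p0 Vp.
have isep k : nu.-integrable Om (EFin \o (fun z => p k z.1 * slot k z.2)).
  exact: (integrable_sep T0 (ipk k) (measurable_slot k) (slot_bound k)).
have isum (s : seq nat) : nu.-integrable Om
      (EFin \o (fun z => \sum_(k <- s) p k z.1 * slot k z.2)) /\
    \int[nu]_(z in Om) (\sum_(k <- s) p k z.1 * slot k z.2) =
    \sum_(k <- s) \int[nu]_(z in Om) (p k z.1 * slot k z.2).
  elim: s => [|k s [IH1 IH2]].
    have -> : (fun z : R * R => \sum_(k <- [::]) p k z.1 * slot k z.2) = (fun=> 0).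
      by apply/funext => z; rewrite big_nil.
    by rewrite big_nil Rintegral_cst ?mul0r//; split => //; exact: integrable0.
  have -> : (fun z : R * R => \sum_(j <- k :: s) p j z.1 * slot j z.2) =
      (fun z => p k z.1 * slot k z.2 + \sum_(j <- s) p j z.1 * slot j z.2).
    by apply/funext => z; rewrite big_cons.
  by rewrite big_cons -IH2 RintegralD//; split => //; exact: (integrableD mO (isep k) IH1).
have [i1 i2] := isum (index_iota 1 N.+1).
apply: (@le_trans _ _ (\int[nu]_(z in Om) (\sum_(k <- index_iota 1 N.+1) p k z.1 * slot k z.2))).
  by apply: le_Rintegral => //; exact: integrable_dotvv.
rewrite i2; apply: ler_sum => k _.
rewrite (Rintegral_sep (ipk k) (integrable_slot k)) => [|s _|t _].
- by rewrite ler_wpM2l ?Rintegral_slot//; apply: Rintegral_ge0.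
- exact: p0.
- by have /andP[] := slot_itv k t.
Qed.

Lemma pw_norm F : (forall k, inL2 mu D1 (F k)) ->
  ip nu Om (pw F) (pw F) <=
  \sum_(k <- index_iota 1 N.+1) 2 * (ip mu D1 (F k) (F k) + ip mu D1 (F k.-1) (F k.-1)) * tau.
Proof.
move=> F2.
pose p k s := 2 * (dotv (F k s) (F k s) + dotv (F k.-1 s) (F k.-1 s)).
have iD k : mu.-integrable D1
    (EFin \o (fun s => dotv (F k s) (F k s) + dotv (F k.-1 s) (F k.-1 s))).
  exact: (integrableD mD1 (integrable_dotvv (F2 k)) (integrable_dotvv (F2 k.-1))).
have ipk k : mu.-integrable D1 (EFin \o p k).
  by have := integrableZl mD1 2 (iD k); exact: eq_integrable.
have := slot_sum_bound (pw_inL2 F2) ipk.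
have p0 k s : 0 <= p k s by rewrite mulr_ge0// addr_ge0 ?dotv_ge0.
have E k : \int[mu]_(s in D1) p k s =
    2 * (ip mu D1 (F k) (F k) + ip mu D1 (F k.-1) (F k.-1)).
  by rewrite /p RintegralZl// RintegralD//; exact: integrable_dotvv.
under eq_bigr do rewrite E.
apply => // z [_ /= z2]; have [j [jN /andP[tj jt]] sel] := slot_select z2.
rewrite (pw_at _ jN sel).
have -> : \sum_(k <- index_iota 1 N.+1) p k z.1 * slot k z.2 = p j z.1.
  rewrite -(@sum_slot R^o (fun k => p k z.1) _ _ jN sel).
  by apply: eq_bigr => k _; rewrite mulrC.
(* On its slot the interpolant is a convex combination of two consecutive states, so both squared
   weights are at most 1; the factor 2 is that of [dotv_addsq]. *)
set th := (_ / _); set A := F j z.1; set B := F j.-1 z.1.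
have th01 : 0 <= th <= 1.
  have t0 := tau_gt0; have /andP[_ tt] := tk_pred j.
  rewrite /th divr_ge0 ?subr_ge0 ?(ltW tj) ?(ltW t0)//=.
  by rewrite ler_pdivrMr// mul1r lerBlDl (le_trans jt).
clearbody th.
have -> : th *: (A - B) + B = th *: A + (1 - th) *: B.
  by apply/rowP => i; rewrite !mxE; ring.
apply: le_trans (dotv_addsq _ _) _; rewrite !(dotvZl, dotvZr) !mulrA -!expr2 /p.
have /andP[th0 th1] := th01.
have q1 : th ^+ 2 <= 1 by rewrite expr_le1.
have q2 : (1 - th) ^+ 2 <= 1 by rewrite expr_le1 ?subr_ge0// lerBlDr lerDl.
by rewrite ler_pM2l//; apply: lerD; apply: ler_piMl => //; exact: dotv_ge0.
Qed.

(** Serves twice: with F = r for the velocity, and with the second derivatives for the mixed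
    derivative. *)
Lemma dpw_norm F : (forall k, inL2 mu D1 (F k)) ->
  ip nu Om (dpw F) (dpw F) <=
  \sum_(k <- index_iota 1 N.+1)
    (tau ^- 2 * ip mu D1 (fun s => F k s - F k.-1 s) (fun s => F k s - F k.-1 s)) * tau.
Proof.
move=> F2.
pose q k s := dotv (F k s - F k.-1 s) (F k s - F k.-1 s).
pose p k s := tau ^- 2 * q k s.
have iq k : mu.-integrable D1 (EFin \o q k).
  exact: (integrable_dotvv (inL2_diff k F2)).
have ipk k : mu.-integrable D1 (EFin \o p k).
  by have := integrableZl mD1 (tau ^- 2) (iq k); exact: eq_integrable.
have p0 k s : 0 <= p k s by rewrite mulr_ge0 ?dotv_ge0// invr_ge0 sqr_ge0.
have := slot_sum_bound (dpw_inL2 F2) ipk p0.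
have E k : \int[mu]_(s in D1) p k s =
    tau ^- 2 * ip mu D1 (fun s => F k s - F k.-1 s) (fun s => F k s - F k.-1 s).
  by rewrite /p RintegralZl.
under eq_bigr do rewrite E.
apply => z [_ /= z2]; have [j [jN /andP[tj jt]] sel] := slot_select z2.
have -> : dpw F z = tau^-1 *: (F j z.1 - F j.-1 z.1).
  rewrite -(sum_slot (fun k => tau^-1 *: (F k z.1 - F k.-1 z.1)) jN sel).
  by apply: eq_bigr => k _; rewrite /sep scalerA mulrC.
have -> : \sum_(k <- index_iota 1 N.+1) p k z.1 * slot k z.2 = p j z.1.
  rewrite -(@sum_slot R^o (fun k => p k z.1) _ _ jN sel).
  by apply: eq_bigr => k _; rewrite mulrC.
by rewrite dotvZl dotvZr mulrA -invfM -expr2.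
Qed.

End Interpolant.

Theorem proposition8 (R : realType) (L T omega b : R)
    (hL : 0 < L) (hT : 0 < T) (homega : 0 < omega) (hb : 0 < b)
    (eg : 'rV[R]_3) (heg : normv eg = 1)
    (f : R * R -> 'rV[R]_3)
    (hf : {within `[0, L] `*` `[0, T], continuous f}) :
  exists K : R, 0 < K /\
    forall (N : nat) (r : nat -> H2 L), (0 < N)%N ->
    discrete_solution T omega b eg f N r ->
    [/\ forall k : nat, (1 <= k <= N)%N ->
          (L2norm leb1 (OmegaL L) (Dr T N r k) <= K%:E)%E,
        forall k : nat, (k <= N)%N ->
          (L2norm leb1 (OmegaL L) (H2dss (r k)) <= K%:E)%E
      & exists rt : H21 L T,
          [/\ H21fun rt = interpolant T N r,
              (H21norm rt <= K%:E)%E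
            & exists g : R * R -> 'rV[R]_3,
                [/\ inL2 leb2 (Omega L T) g,
                    weak_deriv2 L T 2 0 (H21dt rt) g
                  & ((tau T N)%:E * L2norm leb2 (Omega L T) g ^+ 2
                      <= K%:E)%E]]].
Proof.
have [K1 K10 bounds] := uniform_bounds eg hL hT homega hb hf.
(* By [pw_norm], each of the N slots of length tau contributes at most 2 (K1 + K1) tau to the
   squared norm of an interpolant. *)
pose K2 := 4 * K1 * T.
have K20 : 0 <= K2 by rewrite mulr_ge0 ?(ltW hT)// mulr_ge0.
have K1T : 0 <= K1 * T by rewrite mulr_ge0 ?(ltW hT).
(* 3 K2 accounts for the interpolant and its two derivatives in s, K1 T for its derivative in t. The
   summand 1 gives K <= K^2, so that bounds by K on squared norms are bounds by K on norms. *)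
pose K := 1 + K1 + 3 * K2 + K1 * T.
have K1K : 1 + K1 <= K by rewrite /K; lra.
have Kge1 : 1 <= K by rewrite /K; lra.
have K0 : 0 < K by lra.
have KK : K <= K ^+ 2 by rewrite expr2 ler_peMr// ltW.
exists K; split => // N r N0 sol; have [bd bnd bQ] := bounds N r N0 sol.
have tau0 := tau_gt0 hT N0.
have mD := @mOmegaL R L; have mO := @mOmega R L T.
have r2 k : inL2 leb1 (OmegaL L) (r k) := H2_fun_inL2 (r k).
have ds2 k : inL2 leb1 (OmegaL L) (H2ds (r k)) := H2_ds_inL2 (r k).
have dss2 k : inL2 leb1 (OmegaL L) (H2dss (r k)) := H2_dss_inL2 (r k).
have rw1 k : weak_deriv1 L 1 (r k) (H2ds (r k)) by case: (H2_weak (r k)).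
have rw2 k : weak_deriv1 L 2 (r k) (H2dss (r k)) by case: (H2_weak (r k)).
split.
- move=> k kN; have d2 : inL2 leb1 (OmegaL L) (fun s => r k s - r k.-1 s) by exact: inL2B.
  apply: (L2norm_le mD); [exact: ltW|exact: inL2Z|].
  rewrite (ipZ mD _ d2); last exact: inL2Z.
  rewrite (ipC leb1 _ (fun s => r k s - r k.-1 s)) (ipZ mD _ d2 d2) mulrA -expr2 exprVn.
  apply: le_trans (bd k kN) _; lra.
- move=> k kN; have [_ _ Sk] := bnd k kN.
  by apply: (L2norm_le mD) => //; [exact: ltW|lra].
have NT : N%:R * tau T N = T.
  by rewrite /tau mulrCA divff ?mulr1// pnatr_eq0 -lt0n.
have sum_cst (c : R) : \sum_(k <- index_iota 1 N.+1) c = N%:R * c.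
  by rewrite big_const_seq count_predT size_iota subn1 iter_addr_0 mulr_natl.
have pwK (F : nat -> R -> 'rV[R]_3) : (forall k, inL2 leb1 (OmegaL L) (F k)) ->
    (forall k, (k <= N)%N -> ip leb1 (OmegaL L) (F k) (F k) <= K1) ->
    ip leb2 (Omega L T) (pw T N F) (pw T N F) <= K2.
  move=> F2 FK; apply: le_trans (pw_norm hT N0 F2) _.
  apply: (@le_trans _ _ (\sum_(k <- index_iota 1 N.+1) 4 * K1 * tau T N)).
    rewrite big_seq [leRHS]big_seq; apply: ler_sum => k; rewrite mem_index_iota ltnS.
    move=> /andP[k1 kN]; rewrite ler_pM2r//.
    have := FK k kN; have := FK k.-1 (leq_trans (leq_pred k) kN); lra.
  by rewrite sum_cst mulrCA NT.
pose rt := MkH21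
  (And4 (pw_inL2 hT N0 r2) (pw_inL2 hT N0 ds2) (pw_inL2 hT N0 dss2) (dpw_inL2 hT N0 r2))
  (And3 (pw_weak_s hL hT N0 r2 ds2 rw1) (pw_weak_s hL hT N0 r2 dss2 rw2)
        (pw_weak_t hL hT N0 r2)).
exists rt; split.
- by [].
- rewrite /H21norm.
  rewrite (L2norm_sq_ip mO (pw_inL2 hT N0 r2)) (L2norm_sq_ip mO (pw_inL2 hT N0 ds2)).
  rewrite (L2norm_sq_ip mO (pw_inL2 hT N0 dss2)) (L2norm_sq_ip mO (dpw_inL2 hT N0 r2)).
  have b1 := pwK _ r2 (fun k kN => let: And3 h _ _ := bnd k kN in h).
  have b2 := pwK _ ds2 (fun k kN => let: And3 _ h _ := bnd k kN in h).
  have b3 := pwK _ dss2 (fun k kN => let: And3 _ _ h := bnd k kN in h).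
  have b4 : ip leb2 (Omega L T) (dpw T N r) (dpw T N r) <= K1 * T.
    apply: le_trans (dpw_norm hT N0 r2) _.
    apply: (@le_trans _ _ (\sum_(k <- index_iota 1 N.+1) K1 * tau T N)).
      rewrite big_seq [leRHS]big_seq; apply: ler_sum => k; rewrite mem_index_iota ltnS.
      by move=> kN; rewrite ler_pM2r// bd.
    by rewrite sum_cst mulrCA NT.
  have -> : (K%:E = sqrte (K%:E ^+ 2))%E.
    by rewrite sqrte_sqr gee0_abs// lee_fin ltW.
  rewrite lee_sqrt ?sqre_ge0// -!EFinD -EFin_expe lee_fin.
  by apply: le_trans KK; rewrite /K; lra.
(* The time derivative is piecewise constant in t with values the difference quotients of r_k, so
   its second s-derivative is built from those of the second derivatives. *)
exists (dpw T N (fun k => H2dss (r k))); split.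
- exact: dpw_inL2.
- exact: dpw_weak_s.
rewrite (L2norm_sq_ip mO (dpw_inL2 hT N0 dss2)) -EFinM lee_fin.
apply: le_trans (ler_wpM2l (ltW tau0) (dpw_norm hT N0 dss2)) _.
rewrite mulr_sumr.
(* The powers of tau cancel: tau from the statement, tau^-2 from the difference quotients and tau
   from the length of a slot. What remains is the accumulated dissipation. *)
rewrite (eq_bigr (fun k => ip leb1 (OmegaL L) (fun s => H2dss (r k) s - H2dss (r k.-1) s)
                           (fun s => H2dss (r k) s - H2dss (r k.-1) s))).
  by apply: le_trans bQ _; lra.
by move=> k _; field; rewrite gt_eqF.
Qed.
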